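(* Let $\mathcal{S}_0$ be a nonempty set of parameters $(a,b,w,\mu)$ which is compact in the topology of $$L^1((0,T);L^2(Y))\times L^1((0,T);L^2(Y\times Y))\times L^2\big(U;L^2(Y)\text{ weak}\big)\times L^2(U).$$ Then the loss functional $J$ has a minimizer over $\mathcal{S}_0$, i.e. there is $(a_0,b_0,w_0,\mu_0)\in\mathcal{S}_0$ with $J(a_0,b_0,w_0,\mu_0)=\inf_{\mathcal{S}_0}J$.
   Context: Setting: $Y\subseteq\mathbb{R}^d$ and $U\subseteq\mathbb{R}^l$ are bounded open sets with Lebesgue measure, $0<T<\infty$, $N\in\mathbb{N}$; $\sigma,h:\mathbb{R}\to\mathbb{R}$ are uniformly Lipschitz-continuous; training data $(f_I^{(j)},P^{(j)})\in L^2(Y)\times L^2(U)$, $j=1,\dots,N$, are given with $f_I^{(i)}\ne f_I^{(j)}$ for $i\neq j$. For $a\in L^1((0,T);L^2(Y))$, $b\in L^1((0,T);L^2(Y\times Y))$ let $f^{(j)}\in C([0,T];L^2(Y))$ be the unique (integral) solution of $$\partial_t f^{(j)}(y,t)=\sigma\Big(a(y,t)-\int_Y b(y,z,t)f^{(j)}(z,t)\,dz\Big),\qquad f^{(j)}(y,0)=f_I^{(j)}(y).$$ For $w\in L^2(U\times Y)$, $\mu\in L^2(U)$ put $Z^{(j)}(u)=\int_Y w(u,y)f^{(j)}(y,T)\,dy+\mu(u)$, $P^{(j)}_{\mathrm{pre}}(u)=h(Z^{(j)}(u))$ and $$J(a,b,w,\mu)=\frac1{2N}\sum_{j=1}^N\int_U\big|P^{(j)}_{\mathrm{pre}}(u)-P^{(j)}(u)\big|^2du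 .$$ The topology $L^2(U;L^2(Y)\text{ weak})$ on $L^2(U\times Y)$ is strong in $u$ and weak in $y$: it is generated by the seminorms $w\mapsto\big\|\int_Y w(\cdot,y)\varphi(y)\,dy\big\|_{L^2(U)}$, $\varphi\in L^2(Y)$. *)

(* Defs.v *)
From HB Require Import structures.
From mathcomp Require Import all_boot all_order all_algebra.
From mathcomp Require Import all_classical all_reals all_analysis.

Set Implicit Arguments.
Unset Strict Implicit.
Unset Printing Implicit Defensive.

Import Order.TTheory GRing.Theory Num.Theory.
Import numFieldNormedType.Exports.

Local Open Scope classical_set_scope.
Local Open Scope ring_scope.

Section rV_measurable.
Context {R : realType} (n : nat).

Let coor (i : 'I_n) (x : 'rV[R]_n) : measurableTypeR R := x ord0 i.

Let rV_set0 : g_sigma_preimage coor set0.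
Proof. exact: sigma_algebra0. Qed.

Let rV_setC A : g_sigma_preimage coor A -> g_sigma_preimage coor (~` A).
Proof. exact: sigma_algebraC. Qed.

Let rV_bigcup (F : _^nat) : (forall i, g_sigma_preimage coor (F i)) ->
  g_sigma_preimage coor (\bigcup_i (F i)).
Proof. exact: sigma_algebra_bigcup. Qed.

(* This is the Borel sigma-algebra, see [open_measurable_rV]. *)
HB.instance Definition _ := @isMeasurable.Build
  (measure_tuple_display (R.-ocitv.-measurable).-sigma)
  'rV[R]_n (g_sigma_preimage coor) rV_set0 rV_setC rV_bigcup.

Lemma measurable_coor (i : 'I_n) :
  measurable_fun [set: 'rV[R]_n] (fun x => x ord0 i : measurableTypeR R).
Proof.
move=> _ Y mY; rewrite setTI; apply: sub_sigma_algebra => /=.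
rewrite -bigcup_seq/=; exists i => /=; first by rewrite mem_index_enum.
by exists Y => //; rewrite setTI.
Qed.

Lemma measurable_fun_rVP d (T : measurableType d) (f : T -> 'rV[R]_n) :
  (forall i, measurable_fun [set: T] (fun t => f t ord0 i : measurableTypeR R)) ->
  measurable_fun [set: T] f.
Proof.
move=> mf _ A mA; rewrite setTI.
suff : [set B | measurable (f @^-1` B)] A by [].
apply: (smallest_sub _ _ mA).
  split => /=.
  - by rewrite preimage_set0.
  - by move=> B mB; rewrite setTD preimage_setC; exact: measurableC.
  - by move=> F mF; rewrite preimage_bigcup; exact: bigcup_measurable.
rewrite -bigcup_seq => B [i _ [C mC <-]] /=.
by rewrite setTI -comp_preimage -[X in measurable X]setTI; exact: mf.
Qed.

Lemma open_measurable_rV (A : set 'rV[R]_n) : open A -> measurable A.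
Proof.
move=> oA.
pose box (p : 'rV[rat]_n * nat) : set 'rV[R]_n :=
  \bigcap_(i : 'I_n) ((fun x : 'rV[R]_n => x ord0 i) @^-1`
     ball (ratr (p.1 ord0 i) : R) p.2.+1%:R^-1).
have mbox p : measurable (box p).
  apply: fin_bigcap_measurable => [|i _].
    by rewrite (_ : setT = [set` predT]) ?predeqE; [exact: finite_finpred|split].
  rewrite -[X in measurable X]setTI.
  by apply: measurable_coor => //; rewrite ball_itv; exact: measurable_itv.
rewrite (_ : A = \bigcup_(p in [set p | box p `<=` A]) box p); last first.
  apply/seteqP; split=> [x Ax|x [p pA px]]; last exact: pA.
  have /nbhs_ballP[e /= e0 xeA] : nbhs x A := open_nbhs_nbhs (conj oA Ax).
  have [k _ k2] := near_infty_natSinv_lt (PosNum (divr_gt0 e0 (ltr0n _ 2))).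
  have ke : k.+1%:R^-1 < e / 2 :> R by have := k2 k (leqnn k).
  have k0 : 0 < k.+1%:R^-1 :> R by rewrite invr_gt0.
  have /choice[c cP] i : exists q : rat, `|ratr q - x ord0 i| < k.+1%:R^-1 :> R.
    have /rat_in_itvoo[q] : x ord0 i - k.+1%:R^-1 < x ord0 i + k.+1%:R^-1.
      by rewrite ltrD2l gtrN.
    by rewrite in_itv /= -ltr_distl => ?; exists q.
  exists (\row_i c i, k) => /=.
    move=> y yb; apply: xeA; split=> // i j; rewrite ord1.
    have := yb j Logic.I; rewrite /= /ball /= mxE => yj.
    have := cP j => cj; rewrite (splitr e).
    rewrite (le_lt_trans (ler_distD (ratr (c j)) _ _))//.
    by rewrite ltrD // (lt_trans _ ke) // distrC.
  by move=> i _; rewrite /= /ball /= mxE.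
rewrite bigcup_mkcond; apply: countable_bigcupT_measurable => [|p]; first exact: countableP.
by case: ifP.
Qed.
End rV_measurable.

Lemma sigma_finite_prod d1 d2 (T1 : measurableType d1) (T2 : measurableType d2)
    (R : realType) (m1 : {sigma_finite_measure set T1 -> \bar R})
    (m2 : {sigma_finite_measure set T2 -> \bar R}) :
  sigma_finite setT (m1 \x m2)%E.
Proof.
have /sigma_finiteP[F [TF ndF Foo]] := sigma_finiteT m1.
have /sigma_finiteP[G [TG ndG Goo]] := sigma_finiteT m2.
exists (fun n => F n `*` G n).
  rewrite -setXTT TF TG predeqE => -[x y]; split.
    move=> [/= [n _ Fnx] [k _ Gky]]; exists (maxn n k) => //; split.
    - by move: x Fnx; exact/subsetPset/ndF/leq_maxl.
    - by move: y Gky; exact/subsetPset/ndG/leq_maxr.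
  by move=> [n _ []/= ? ?]; split; exists n.
move=> k; have [? ?] := Foo k; have [? ?] := Goo k.
split; first exact: measurableX.
by rewrite product_measure1E// lte_mul_pinfty// ge0_fin_numE.
Qed.

Section lebesgue_rV.
Context {R : realType}.

Definition rV_cons n (p : measurableTypeR R * 'rV[R]_n) : 'rV[R]_n.+1 :=
  \row_i (if unlift ord0 i is Some j then p.2 ord0 j else p.1).

Lemma measurable_rV_cons n : measurable_fun [set: _] (@rV_cons n).
Proof.
apply: measurable_fun_rVP => i; rewrite /rV_cons.
under eq_fun do rewrite mxE.
case: unliftP => [j _|_]; last exact: measurable_fst.
by apply: (measurableT_comp (measurable_coor j)) => //; exact: measurable_snd.
Qed.

Let rV_uncons n (x : 'rV[R]_n.+1) : measurableTypeR R * 'rV[R]_n :=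
  (x ord0 ord0, \row_j x ord0 (lift ord0 j)).

Let rV_consK n : cancel (@rV_cons n) (@rV_uncons n).
Proof.
move=> [x y]; rewrite /rV_uncons /rV_cons mxE unlift_none /=; congr pair.
by apply/rowP => j; rewrite !mxE liftK.
Qed.

Let measurable_rV_uncons n : measurable_fun [set: _] (@rV_uncons n).
Proof.
apply/measurable_fun_pair => /=; first exact: measurable_coor.
apply: measurable_fun_rVP => i; under eq_fun do rewrite mxE.
exact: measurable_coor.
Qed.

Section step.
Variables (n : nat) (mu : {sigma_finite_measure set 'rV[R]_n -> \bar R}).

Definition lebesgue_rV_step : set 'rV[R]_n.+1 -> \bar R :=
  pushforward (lebesgue_measure \x mu)%E (@rV_cons n).

Let step0 : lebesgue_rV_step set0 = 0%E.
Proof. by rewrite /lebesgue_rV_step /pushforward preimage_set0 measure0. Qed.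

Let step_ge0 A : (0 <= lebesgue_rV_step A)%E.
Proof. by rewrite /lebesgue_rV_step /pushforward measure_ge0. Qed.

Let mpre A : measurable A -> measurable (@rV_cons n @^-1` A).
Proof. by move=> mA; rewrite -[X in measurable X]setTI; exact: measurable_rV_cons. Qed.

Let step_sigma_additive : semi_sigma_additive lebesgue_rV_step.
Proof.
move=> F mF tF mUF; rewrite /lebesgue_rV_step /pushforward preimage_bigcup.
apply: measure_semi_sigma_additive.
- by move=> i; exact: mpre.
- apply/trivIsetP => /= i j _ _ ij; rewrite -preimage_setI.
  by move/trivIsetP : tF => /(_ _ _ _ _ ij) ->//; rewrite preimage_set0.
- by rewrite -preimage_bigcup; exact: mpre.
Qed.

HB.instance Definition _ := isMeasure.Build _ _ _ lebesgue_rV_step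
  step0 step_ge0 step_sigma_additive.

Let step_sigma_finite : sigma_finite setT lebesgue_rV_step.
Proof.
have [F TF Foo] := sigma_finite_prod lebesgue_measure mu.
exists (fun k => @rV_uncons n @^-1` F k).
  by rewrite -preimage_bigcup -TF preimage_setT.
move=> k; split.
  rewrite -[X in measurable X]setTI; apply: measurable_rV_uncons => //.
  by have [] := Foo k.
rewrite /lebesgue_rV_step /pushforward -comp_preimage.
rewrite (_ : _ \o _ = id) ?preimage_id; first by have [] := Foo k.
by apply/funext => p /=; rewrite rV_consK.
Qed.

HB.instance Definition _ := Measure_isSigmaFinite.Build _ _ _ lebesgue_rV_step
  step_sigma_finite.

End step.

Fixpoint lebesgue_rV n : {sigma_finite_measure set 'rV[R]_n -> \bar R} :=
  match n with
  | 0 => \d_ (0 : 'rV[R]_0)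
  | m.+1 => lebesgue_rV_step (lebesgue_rV m)
  end.

End lebesgue_rV.

Section lebesgue_on.
Context {R : realType} (n : nat) (D : set 'rV[R]_n) (oD : open D).

Definition lebesgue_on : set 'rV[R]_n -> \bar R :=
  mrestr (lebesgue_rV n) (open_measurable_rV oD).

HB.instance Definition _ := Measure.on lebesgue_on.

Let sigma_finite_lebesgue_on : sigma_finite setT lebesgue_on.
Proof.
have [F TF Foo] := sigma_finiteT (@lebesgue_rV R n).
exists F => // i; have [mF Fi] := Foo i; split => //.
apply: le_lt_trans Fi; rewrite /lebesgue_on /mrestr le_measure ?inE//.
by apply: measurableI => //; exact: open_measurable_rV.
Qed.

HB.instance Definition _ := Measure_isSigmaFinite.Build _ _ _ lebesgue_on
  sigma_finite_lebesgue_on.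

End lebesgue_on.

(* Elements of [L2 nu] are square-integrable functions, not classes modulo
   almost-everywhere equality: the L^2 norm is a seminorm on [L2 nu], whose
   kernel is equality [%[ae nu]]. *)
Notation L2 nu := (LfunType nu (lee1n 2)).

HB.instance Definition _ d (T : measurableType d) (R : realType)
    (mu : {measure set T -> \bar R}) (p : \bar R) (p1 : (1 <= p)%E) :=
  @Num.Zmodule_isSemiNormed.Build R (LfunType mu p1)
    (fun f => fine ('N[mu]_p[EFin \o f])%E)
    (@ler_LnormD _ _ _ mu p p1) (@Lnormr_natmul _ _ _ mu p p1)
    (@LnormrN _ _ _ mu p p1).

(* The type M with the topology generated by the pseudometrics [dist i]. *)
Definition gauge_topology {R : realType} {M I : Type}
  (dist : I -> M -> M -> R) : Type := M.

Section gauge_topology.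
Context {R : realType} {M : choiceType} {I : Type} (dist : I -> M -> M -> R).

Definition gauge_open (A : set M) := forall x, A x ->
  exists e F, [/\ 0 < e, finite_set F &
    [set y | forall i, F i -> dist i x y < e] `<=` A].

Let gauge_openT : gauge_open setT.
Proof. by move=> x _; exists 1, set0; split. Qed.

Let gauge_openI : setI_closed gauge_open.
Proof.
move=> A B oA oB x [/oA[e [F [e0 fF FA]]] /oB[e' [F' [e'0 fF' FB]]]].
exists (Num.min e e'), (F `|` F'); split.
- by rewrite lt_min e0.
- by rewrite finite_setU.
- move=> y xy; split.
  + by apply: FA => i Fi; have := xy i (or_introl Fi); rewrite lt_min => /andP[].
  + by apply: FB => i Fi; have := xy i (or_intror Fi); rewrite lt_min => /andP[].
Qed.

Let gauge_open_bigU (J : Type) (f : J -> set M) :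
  (forall j, gauge_open (f j)) -> gauge_open (\bigcup_j f j).
Proof.
move=> of_ x [j _ /of_[e [F [e0 fF Ff]]]].
by exists e, F; split => // y /Ff; exists j.
Qed.

HB.instance Definition _ := Choice.on (gauge_topology dist).
HB.instance Definition _ := isOpenTopological.Build (gauge_topology dist)
  gauge_openT gauge_openI gauge_open_bigU.

End gauge_topology.

Section bochner.
Context {d1 d2} {T : measurableType d1} {X : measurableType d2} {R : realType}.
Variables (mu : {measure set T -> \bar R}) (nu : {measure set X -> \bar R}).

(* Simple functions sum_i 1_{A_i} v_i; the sets A_i may overlap. *)
Record simple_fun := SimpleFun {
  sf_size : nat ;
  sf_set : 'I_sf_size -> set T ;
  sf_val : 'I_sf_size -> L2 nu ;
  sf_measurable : forall i, measurable (sf_set i) ;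
  sf_finite : forall i, (mu (sf_set i) < +oo)%E }.

Definition sf_eval (s : simple_fun) (t : T) : L2 nu :=
  \sum_i (\1_(sf_set i) t : R) *: sf_val (s := s) i.

Definition sf_integral (s : simple_fun) : L2 nu :=
  \sum_i fine (mu (sf_set i)) *: sf_val (s := s) i.

(* Convergence is required at every t: every class modulo almost-everywhere
   equality of a.e. limits of simple functions contains such a function. *)
Definition strongly_measurable (g : T -> L2 nu) :=
  exists s : nat -> simple_fun,
    forall t, `|g t - sf_eval (s n) t| @[n --> \oo] --> (0 : R).

Definition is_bochner_integral (g : T -> L2 nu) (v : L2 nu) :=
  strongly_measurable g /\
  exists s : nat -> simple_fun,
    (\int[mu]_t (`|g t - sf_eval (s n) t|%:E))%E @[n --> \oo] --> 0%E /\
    `|v - sf_integral (s n)| @[n --> \oo] --> (0 : R).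

(* Representatives of the elements of L^1(mu; L^2(nu)). *)
Record bochnerL1 := BochnerL1 {
  bochner_fun :> T -> L2 nu ;
  bochner_measurable : strongly_measurable bochner_fun ;
  bochner_integrable : (\int[mu]_t (`|bochner_fun t|%:E) < +oo)%E }.

HB.instance Definition _ := gen_eqMixin bochnerL1.
HB.instance Definition _ := gen_choiceMixin bochnerL1.

Definition bochner_dist (f g : bochnerL1) : R :=
  \int[mu]_t `|f t - g t|.

End bochner.

Definition L2_strong d (T : measurableType d) (R : realType)
    (nu : {measure set T -> \bar R}) :=
  gauge_topology (fun (_ : unit) (f g : L2 nu) => `|f - g| : R).

Definition L1L2_strong d1 d2 (T : measurableType d1) (X : measurableType d2)
    (R : realType) (mu : {measure set T -> \bar R})
    (nu : {measure set X -> \bar R}) :=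
  gauge_topology (fun _ : unit => bochner_dist (mu := mu) (nu := nu)).

(* L^2(U; L^2(Y) weak) on L^2(U x Y). *)
Definition L2_strong_weak d1 d2 (U : measurableType d1) (Y : measurableType d2)
    (R : realType) (muU : {measure set U -> \bar R})
    (muY : {sigma_finite_measure set Y -> \bar R}) :=
  gauge_topology (fun (phi : L2 muY) (w w' : L2 (muU \x muY)%E) =>
    fine ('N[muU]_2%:E[EFin \o (fun u =>
      \int[muY]_y ((w (u, y) - w' (u, y)) * phi y))%R])%E).

Section neural_network.
Context {R : realType} {d l : nat} {Y : set 'rV[R]_d} {U : set 'rV[R]_l}.
Variables (oY : open Y) (oU : open U) (T : R).

Local Notation muY := (lebesgue_on oY).
Local Notation muU := (lebesgue_on oU).

Definition time_measure (t : R) : {measure set (measurableTypeR R) -> \bar R} :=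
  mrestr lebesgue_measure (measurable_itv `]0%R, t[).

Definition param_space : Type :=
  (L1L2_strong (time_measure T) muY *
   L1L2_strong (time_measure T) (muY \x muY)%E *
   L2_strong_weak muU muY *
   L2_strong muU)%type.

Definition is_solution (sigma : R -> R)
    (a : bochnerL1 (time_measure T) muY)
    (b : bochnerL1 (time_measure T) (muY \x muY)%E)
    (fI : L2 muY) (f : R -> L2 muY) :=
  {within `[0, T], continuous (f : R -> L2_strong muY)} /\
  exists2 g : R -> L2 muY,
    {ae time_measure T, forall t, {ae muY, forall y,
      g t y = sigma (a t y - \int[muY]_z (b t (y, z) * f t z))}} &
    forall t, 0 <= t <= T ->
      is_bochner_integral (time_measure t) (g : measurableTypeR R -> _) (f t - fI).

(* Solutions are unique on [0, T], up to equality in L^2(Y) at each t, so the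
   value at T does not depend on the choice made by [xget]. *)
Definition solution sigma a b (fI : L2 muY) : R -> L2 muY :=
  xget (fun=> 0) [set f | is_solution sigma a b fI f].

Definition loss (sigma h : R -> R) (N : nat) (fI : 'I_N -> L2 muY)
    (P : 'I_N -> L2 muU) (p : param_space) : R :=
  let a : bochnerL1 (time_measure T) muY := p.1.1.1 in
  let b : bochnerL1 (time_measure T) (muY \x muY)%E := p.1.1.2 in
  let w : L2 (muU \x muY)%E := p.1.2 in
  let mu : L2 muU := p.2 in
  let Z j u := \int[muY]_y (w (u, y) * solution sigma a b (fI j) T y) + mu u in
  (2 * N%:R)^-1 * \sum_(j < N) \int[muU]_u (`|h (Z j u) - P j u| ^+ 2).

End neural_network.

(* Main.v *)
(* The loss is continuous on S0, so compactness gives a minimizer.  Writing B(t)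
   for the Hilbert-Schmidt operator with kernel b(t), the equation is an ODE
   f' = sigma(a(t) - B(t) f) in L^2(Y) whose right-hand side is Lipschitz in f with
   constant L |b(t)|, integrable in time.  In the norm sup_t exp(-lam t) |f(t)|,
   with lam large, the associated integral operator is a contraction (Bielecki):
   this yields existence by Picard iteration, and uniqueness together with
   continuous dependence of f(T) on (a, b).  The topology on w only gives
   pointwise convergence of the operators with kernel w, but on S0 these are
   uniformly bounded by Banach-Steinhaus, hence the preactivations depend
   continuously on the parameters in L^2(U). *)
Require Import Defs.
From mathcomp Require Import all_boot all_order all_algebra.
From mathcomp Require Import all_classical all_reals all_analysis.
From mathcomp Require Import measurable_realfun ring lra.

Set Implicit Arguments.
Unset Strict Implicit.
Unset Printing Implicit Defensive.

Import Order.TTheory GRing.Theory Num.Theory.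
Import numFieldNormedType.Exports.

Local Open Scope classical_set_scope.
Local Open Scope ring_scope.

(** * The space L^2 *)

(** The norm on [L2 nu] is only a seminorm on functions, so linearity of operators and uniqueness of
    limits and integrals take the form of a distance equal to zero, exchanged inside norms rather
    than rewritten. Limits in L^2 are produced only for sequences whose increments are at most C /
    2^n; the Picard iteration, the primitives in time and the nested balls of Banach-Steinhaus are
    all arranged to meet this rate. The Bochner integral is a relation, and the equation is
    estimated through one inequality: the distance of two integrals is at most the integral of the
    distance. The topology on w is generated by seminorms and is not metrizable in general, so
    continuity of the loss is argued with neighbourhoods, never with sequences of parameters.
    Solutions for nearby parameters come with no common bound; the constants of the stability
    estimate therefore have to depend on the reference solution and its kernel alone. *)

Section L2_norm.
Context d (X : measurableType d) (R : realType) (nu : {measure set X -> \bar R}).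
Implicit Types f g h : L2 nu.

Lemma measurable_L2 f : measurable_fun setT (f : X -> R).
Proof. exact: measurable_funPT. Qed.

Lemma L2_normsqE f : ((`|f| ^+ 2)%:E = \int[nu]_x (f x ^+ 2)%:E)%E.
Proof.
have E : (`|f|%:E = 'N[nu]_2[EFin \o f])%E by rewrite finite_norm_fine.
have := @powR_Lnorm _ _ _ nu (EFin \o f) 2.
rewrite -E poweR_EFin powR_mulrn// => ->//.
by apply: eq_integral => x _ /=; rewrite powR_mulrn// real_normK// num_real.
Qed.

Lemma mem_L2 (f : X -> R) : measurable_fun setT f ->
  (\int[nu]_x (f x ^+ 2)%:E < +oo)%E -> f \in Lfun nu 2%:E.
Proof.
move=> mf fi; rewrite inE; apply/andP; split; rewrite inE//=.
rewrite /finite_norm unlock poweR_lty//.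
by under eq_integral do rewrite /= powR_mulrn// real_normK ?num_real//.
Qed.

Definition mkL2 (f : X -> R) (mf : measurable_fun setT f)
    (fi : (\int[nu]_x (f x ^+ 2)%:E < +oo)%E) : L2 nu :=
  Lfun_Sub (lee1n 2) (mem_L2 mf fi).

Lemma L2E_add f g x : (f + g) x = f x + g x. Proof. by []. Qed.
Lemma L2E_opp f x : (- f) x = - f x. Proof. by []. Qed.
Lemma L2E_scale (a : R) f x : (a *: f) x = a * f x. Proof. by []. Qed.

Lemma L2_normZ (a : R) f : `|a *: f| = `|a| * `|f|.
Proof.
apply: EFin_inj; rewrite EFinM.
have E g : (`|g|%:E = 'N[nu]_2[EFin \o g])%E by rewrite finite_norm_fine.
by rewrite !E; exact: LnormZ.
Qed.

Lemma L2_norm_lt_inty f : (\int[nu]_x (f x ^+ 2)%:E < +oo)%E.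
Proof. by rewrite -L2_normsqE ltry. Qed.

Lemma le_L2_norm f g (c : R) : 0 <= c ->
  {ae nu, forall x, `|f x| <= c * `|g x|} -> `|f| <= c * `|g|.
Proof.
move=> c0 fg; rewrite -(@ler_pXn2r _ 2)// ?nnegrE ?mulr_ge0//.
rewrite exprMn -lee_fin L2_normsqE EFinM L2_normsqE -ge0_integralZl_EFin//.
- apply: ae_ge0_le_integral => //.
  + by move=> x _; rewrite lee_fin sqr_ge0.
  + by apply/measurable_EFinP; apply: measurable_funX; exact: measurable_L2.
  + by move=> x _; rewrite lee_fin mulr_ge0// sqr_ge0.
  + apply/measurable_EFinP; apply: measurable_funM => //.
    by apply: measurable_funX; exact: measurable_L2.
  + apply: filterS fg => x fg _; rewrite lee_fin.
    rewrite -(real_normK (num_real (f x))) -(real_normK (num_real (g x))).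
    by rewrite -exprMn ler_pXn2r// ?nnegrE ?mulr_ge0.
- by move=> x _; rewrite lee_fin sqr_ge0.
- by apply/measurable_EFinP; apply: measurable_funX; exact: measurable_L2.
- exact: sqr_ge0.
Qed.

Lemma L2_norm_ae0 f : {ae nu, forall x, f x = 0} -> `|f| = 0.
Proof.
move=> f0; apply/eqP; rewrite eq_le normr_ge0 andbT.
rewrite -(mul0r `|0 : L2 nu|); apply: le_L2_norm => //.
by apply: filterS f0 => x ->; rewrite normr0 mul0r.
Qed.

(** Stands in for rewriting: elements at distance zero need not be equal as functions, but can be
    exchanged inside any distance. *)
Lemma L2_dist_eq f g h : `|f - g| = 0 -> `|f - h| = `|g - h|.
Proof.
move=> fg; apply/eqP; rewrite eq_le; apply/andP; split.
  by rewrite (le_trans (ler_distD g _ _))// fg add0r.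
by rewrite (le_trans (ler_distD f _ _))// distrC fg add0r.
Qed.

Lemma L2_mul_integrable f g : nu.-integrable setT (fun x => (f x * g x)%:E).
Proof.
apply/Lfun1_integrable; apply: Lfun2_mul_Lfun1; exact: LfunP.
Qed.

Lemma L2_integral_le f g : ((\int[nu]_x `|f x * g x|%:E) <= (`|f| * `|g|)%:E)%E.
Proof.
have := @hoelder _ _ _ nu f g 2 2 (measurable_L2 f) (measurable_L2 g).
rewrite Lnorm1 /= => /(_ _ _ _)/le_trans; apply => //.
  by rewrite [RHS]splitr !div1r.
have E h : (`|h|%:E = 'N[nu]_2[EFin \o h])%E by rewrite finite_norm_fine.
by rewrite EFinM !E.
Qed.

Lemma cauchy_schwarz_L2 f g : `|\int[nu]_x (f x * g x)| <= `|f| * `|g|.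
Proof.
have h := L2_mul_integrable f g.
rewrite (le_trans (le_normr_Rintegral _ h))//.
rewrite -lee_fin (le_trans _ (L2_integral_le f g))//.
rewrite /Rintegral fineK//.
have := integrable_fin_num measurableT (integrable_norm h).
by [].
Qed.

End L2_norm.

Lemma cvg_half_pow (R : realType) (c : R) : c / 2 ^+ n @[n --> \oo] --> (0 : R).
Proof.
rewrite (_ : (fun n => _) = geometric c 2^-1).
  by apply: cvg_geometric; rewrite ger0_norm// invf_lt1// ltr1n.
by apply/funext => n; rewrite /geometric/= exprVn.
Qed.

Lemma le_half_pow (R : realType) (x y c : R) :
  (forall n, x <= y + c / 2 ^+ n) -> x <= y.
Proof.
move=> h; apply/ler_addgt0Pr => e e0.
have /cvgrPdist_lt/(_ _ e0)[n _ nP] := cvg_half_pow c.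
have := nP n (leqnn n); rewrite /= sub0r normrN => ne.
by rewrite (le_trans (h n))// lerD2l (le_trans (ler_norm _))// ltW.
Qed.

Lemma geometric_steps_ge0 (R : realType) (V : semiNormedZmodType R) (x : nat -> V)
    (C : R) : (forall n, `|x n.+1 - x n| <= C / 2 ^+ n) -> 0 <= C.
Proof.
by move=> /(_ 0%N); rewrite expr0 divr1; apply: le_trans; exact: normr_ge0.
Qed.

Lemma geometric_steps_dist (R : realType) (V : semiNormedZmodType R) (x : nat -> V)
    (C : R) : (forall n, `|x n.+1 - x n| <= C / 2 ^+ n) ->
  forall n m, (n <= m)%N -> `|x m - x n| <= 2 * C / 2 ^+ n.
Proof.
move=> xC n m nm; rewrite -(subnK nm) addnC.
have C0 := geometric_steps_ge0 xC.
(* The partial geometric sum is kept exactly, so that the induction closes with an equality. *)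
suff h k : `|x (n + k)%N - x n| <= 2 * C / 2 ^+ n * (1 - 1 / 2 ^+ k).
  rewrite (le_trans (h _))// ler_piMr// ?gerBl ?divr_ge0//.
  by rewrite mulr_ge0.
elim: k => [|k ih]; first by rewrite addn0 subrr normr0 expr0 divr1 subrr mulr0.
rewrite addnS (le_trans (ler_distD (x (n + k)%N) _ _))//.
rewrite (le_trans (lerD (xC _) ih))// exprD exprS.
have ? : 2 ^+ n != 0 :> R by rewrite expf_neq0.
have ? : 2 ^+ k != 0 :> R by rewrite expf_neq0.
rewrite le_eqVlt; apply/orP; left; apply/eqP; field.
by apply/andP; split.
Qed.

(** * Completeness of L^2 over a finite measure *)

Section L2_complete.
Context d (X : measurableType d) (R : realType) (nu : {measure set X -> \bar R}).
Hypothesis nufin : (nu setT < +oo)%E.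

Lemma cst_L2_subproof (c : R) : (\int[nu]_x ((cst c x) ^+ 2)%:E < +oo)%E.
Proof.
rewrite (_ : (fun x => (cst c x ^+ 2)%:E) = cst (c ^+ 2)%:E)//.
by rewrite integral_cst//= lte_mul_pinfty// ?lee_fin ?sqr_ge0.
Qed.

Definition cstL2 (c : R) : L2 nu :=
  @mkL2 _ X R nu (cst c) (measurable_cst c) (cst_L2_subproof c).

Lemma L1_le_L2 (f : L2 nu) : (\int[nu]_x `|f x|%:E <= (`|f| * `|cstL2 1|)%:E)%E.
Proof.
apply: le_trans (L2_integral_le f (cstL2 1)).
by under [leRHS]eq_integral do rewrite /= mulr1.
Qed.

(** As [nu] is finite, L^2 norms of the increments control their L^1 norms, which are thus summable.
    The sum of the absolute increments is then integrable, hence finite almost everywhere, and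
    telescoping gives convergence. *)
Lemma geometric_steps_ae_cvg (x : nat -> L2 nu) (C : R) :
  (forall n, `|x n.+1 - x n| <= C / 2 ^+ n) ->
  {ae nu, forall t, cvgn (fun n => x n t : R)}.
Proof.
move=> xC; pose u n : L2 nu := x n.+1 - x n.
have C0 := geometric_steps_ge0 xC.
have mu_ n : measurable_fun setT (fun t => `|u n t|%:E).
  by apply/measurable_EFinP; apply: measurableT_comp => //; exact: measurable_L2.
have sum_fin : (\int[nu]_t (\sum_(n <oo) `|u n t|%:E) < +oo)%E.
  rewrite integral_nneseries//.
  apply: (@le_lt_trans _ _ (2 * C * `|cstL2 1|)%:E); last by rewrite ltry.
  apply: lime_le; first by apply: is_cvg_nneseries => n _ _; exact: integral_ge0.
  apply: nearW => n.
  apply: (@le_trans _ _ (\sum_(0 <= i < n) (C / 2 ^+ i * `|cstL2 1|)%:E)%E).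
    apply: lee_sum => i _; rewrite (le_trans (L1_le_L2 _))// lee_fin ler_wpM2r//.
    exact: xC.
  rewrite sumEFin lee_fin -mulr_suml ler_wpM2r//.
  suff -> : \sum_(0 <= i < n) C / 2 ^+ i = 2 * C * (1 - 1 / 2 ^+ n).
    by rewrite ler_piMr ?mulr_ge0// gerBl divr_ge0.
  elim: n => [|n ih]; first by rewrite big_geq// expr0 divr1 subrr mulr0.
  rewrite big_nat_recr//= ih exprS.
  have ? : 2 ^+ n != 0 :> R by rewrite expf_neq0.
  by field.
have : nu.-integrable setT (fun t => \sum_(n <oo) `|u n t|%:E)%E.
  apply/integrableP; split; first exact: ge0_emeasurable_sum.
  under eq_integral do rewrite gee0_abs ?nneseries_ge0//.
  by [].
move/(integrable_ae measurableT); apply: filterS => t /(_ Logic.I) tfin.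
have cu : cvgn (series (fun n => `|u n t|)).
  apply: nondecreasing_is_cvgn.
    apply/nondecreasing_seqP => n; rewrite /series/= big_nat_recr//= lerDl.
    exact: normr_ge0.
  exists (fine (\sum_(n <oo) `|u n t|%:E)%E) => _ [n _ <-].
  rewrite -lee_fin fineK// /series/= -sumEFin.
  by apply: nneseries_lim_ge => k _ _; rewrite lee_fin.
have := normed_cvg (V := R^o) (u_ := fun n => u n t) cu.
have -> : (fun n => x n t) = (fun n => x 0%N t + series (fun n => u n t) n).
  apply/funext => n; rewrite /series/=.
  have : \sum_(0 <= k < n) (x k.+1 t - x k t) = x n t - x 0%N t.
    by rewrite telescope_sumr.
  by rewrite (eq_bigr (fun k => u k t))// => ->; rewrite addrC subrK.
by move=> h; apply: is_cvgD => //; exact: is_cvg_cst.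
Qed.

Lemma L2_complete (x : nat -> L2 nu) (C : R) :
  (forall n, `|x n.+1 - x n| <= C / 2 ^+ n) ->
  exists y : L2 nu, forall n, `|y - x n| <= 2 * C / 2 ^+ n.
Proof.
move=> xC.
(* The limit superior is measurable without any convergence; [fine] sends its infinite values, which
   occur on a null set only, to 0. *)
pose y t := fine (limn_esup (fun n => (x n t)%:E)).
have my : measurable_fun setT y.
  apply: measurableT_comp => //; apply: measurable_fun_limn_esup => n.
  apply/measurable_EFinP. exact: measurable_L2.
have C0 := geometric_steps_ge0 xC.
have xy : {ae nu, forall t, x n t @[n --> \oo] --> y t}.
  apply: filterS (geometric_steps_ae_cvg xC) => t cx.
  rewrite /y (_ : limn_esup _ = (limn (fun n => x n t))%:E)//.
  apply: (cvg_limn_einf_sup _).2.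
  by apply: cvg_EFin => //; exact: nearW.
have msq n m : measurable_fun setT (fun t => ((x m t - x n t) ^+ 2)%:E).
  apply/measurable_EFinP; apply: measurable_funX.
  by apply: measurable_funB; exact: measurable_L2.
(* Fatou's lemma: almost everywhere [y - x n] is the limit in m of [x m - x n], whose norm is at
   most [2 * C / 2 ^+ n] once m is at least n. *)
have bnd n : (\int[nu]_t ((y t - x n t) ^+ 2)%:E <= ((2 * C / 2 ^+ n) ^+ 2)%:E)%E.
  apply: (@le_trans _ _ (\int[nu]_t limn_einf (fun m => ((x m t - x n t) ^+ 2)%:E))%E).
    apply: ae_ge0_le_integral => //.
    - by move=> t _; rewrite lee_fin sqr_ge0.
    - apply/measurable_EFinP; apply: measurable_funX; apply: measurable_funB.
        exact: my.
      exact: measurable_L2.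
    - move=> t _; rewrite limn_einf_lim; apply: lime_ge; first exact: is_cvg_einfs.
      by apply: nearW => m; apply: le_ereal_inf_tmp => _ [k _ <-]; rewrite lee_fin sqr_ge0.
    - apply: (emeasurable_fun_cvg (fun k t => einfs (fun m => ((x m t - x n t) ^+ 2)%:E) k)).
        by move=> k; exact: measurable_fun_einfs.
      by move=> t _; rewrite limn_einf_lim; exact: is_cvg_einfs.
    - apply: filterS xy => t xyt _; rewrite (_ : limn_einf _ = ((y t - x n t) ^+ 2)%:E)//.
      apply: (cvg_limn_einf_sup _).1; apply: cvg_EFin; first exact: nearW.
      have h : (x m t - x n t : R^o) @[m --> \oo] --> (y t - x n t : R^o).
        by apply: cvgB => //; exact: cvg_cst.
      exact: (cvgM h h).
  apply: (le_trans (fatou _ measurableT _ _)) => //.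
    by move=> m t _; rewrite lee_fin sqr_ge0.
  rewrite limn_einf_lim; apply: lime_le; first exact: is_cvg_einfs.
  near=> m; apply: ereal_inf_le; exists (\int[nu]_x0 ((x m x0 - x n x0) ^+ 2)%:E)%E.
    by exists m => /=.
  rewrite -(L2_normsqE (x m - x n)) lee_fin ler_pXn2r ?nnegrE ?mulr_ge0 ?invr_ge0//.
  by apply: geometric_steps_dist => //; near: m; exact: nbhs_infty_ge.
have my0 : measurable_fun setT (fun t => y t - x 0%N t).
  by apply: measurable_funB; [exact: my|exact: measurable_L2].
have y0fin : (\int[nu]_t ((y t - x 0%N t) ^+ 2)%:E < +oo)%E.
  by rewrite (le_lt_trans (bnd 0%N))// ltry.
(* The bound at n = 0 makes [y - x 0] square integrable, and the limit is rebuilt as this difference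
   plus [x 0]. *)
exists (mkL2 my0 y0fin + x 0%N) => n.
rewrite -(@ler_pXn2r _ 2)// ?nnegrE ?mulr_ge0 ?invr_ge0// -lee_fin L2_normsqE.
apply: le_trans (bnd n); rewrite le_eqVlt; apply/orP; left; apply/eqP.
apply: eq_integral => t _; congr (_ ^+ 2)%:E.
have -> : (mkL2 my0 y0fin + x 0%N - x n) t = y t - x 0%N t + x 0%N t - x n t by [].
by rewrite subrK.
Unshelve. all: by end_near.
Qed.

End L2_complete.

(** * Kernel operators and superposition operators *)

Section kernel_operator.
Context dU dY (U : measurableType dU) (Y : measurableType dY) (R : realType).
Variables (muU : {sigma_finite_measure set U -> \bar R})
  (muY : {sigma_finite_measure set Y -> \bar R}).
Implicit Types (w : L2 (muU \x muY)%E) (phi : L2 muY).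

Definition kernel_int w phi (u : U) : R := \int[muY]_y (w (u, y) * phi y).

Let measurable_kernel w phi :
  measurable_fun setT (fun p : U * Y => (w p * phi p.2)%:E).
Proof.
apply/measurable_EFinP; apply: measurable_funM; first exact: measurable_L2.
by apply: measurableT_comp => //; exact: measurable_L2.
Qed.

Let measurable_section w (u : U) : measurable_fun setT (fun y => w (u, y)).
Proof. by apply: measurableT_comp => //; exact: measurable_L2. Qed.

(** Fubini for [w ^ 2]. The section is offered as an element of [L2 muY], so that Cauchy-Schwarz and
    the integrability of products apply to it. *)
Lemma ae_L2_section w :
  {ae muU, forall u, exists s : L2 muY, forall y, s y = w (u, y)}.
Proof.
have mw2 : measurable_fun setT (fun p => (w p ^+ 2)%:E).
  by apply/measurable_EFinP; apply: measurable_funX; exact: measurable_L2.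
have iw : (muU \x muY)%E.-integrable setT (fun p => (w p ^+ 2)%:E).
  apply/integrableP; split => //.
  under eq_integral do rewrite gee0_abs ?lee_fin ?sqr_ge0//.
  exact: L2_norm_lt_inty.
apply: filterS (ae_integrable1 iw) => u /integrableP[_ iu].
have fu : (\int[muY]_y ((fun y => w (u, y)) y ^+ 2)%:E < +oo)%E.
  by move: iu; under eq_integral do rewrite gee0_abs ?lee_fin ?sqr_ge0//.
by exists (mkL2 (measurable_section w u) fu).
Qed.

(** Positive and negative parts are treated separately because Tonelli asks for no integrability:
    [w * phi] need not be integrable on the product when [muU] is infinite. *)
Lemma measurable_kernel_int w phi : measurable_fun setT (kernel_int w phi).
Proof.
apply: measurableT_comp => //.
under eq_fun do rewrite integralE.
pose F (p : U * Y) := (w p * phi p.2)%:E.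
apply: emeasurable_funB.
- have h := @measurable_fun_fubini_tonelli_F _ _ _ _ _ muY F^\+%E.
  rewrite (_ : (fun u => _) = fubini_F muY F^\+%E).
    by apply: h => //; exact: measurable_funepos (measurable_kernel w phi).
  by apply/funext => u; apply: eq_integral => y _; rewrite !funeposE.
- have h := @measurable_fun_fubini_tonelli_F _ _ _ _ _ muY F^\-%E.
  rewrite (_ : (fun u => _) = fubini_F muY F^\-%E).
    by apply: h => //; exact: measurable_funeneg (measurable_kernel w phi).
  by apply/funext => u; apply: eq_integral => y _; rewrite !funenegE.
Qed.

(** Cauchy-Schwarz in y for almost every u, then Tonelli: the operator norm is at most the
    Hilbert-Schmidt norm. *)
Lemma kernel_int_sq_le w phi :
  (\int[muU]_u (kernel_int w phi u ^+ 2)%:E <= ((`|w| * `|phi|) ^+ 2)%:E)%E.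
Proof.
have mw2 : measurable_fun setT (fun p => (w p ^+ 2)%:E).
  by apply/measurable_EFinP; apply: measurable_funX; exact: measurable_L2.
have mF : measurable_fun setT (fun u => \int[muY]_y (w (u, y) ^+ 2)%:E)%E.
  apply: (@measurable_fun_fubini_tonelli_F _ _ _ _ _ muY (fun p => (w p ^+ 2)%:E)) => //.
  by move=> p; rewrite lee_fin sqr_ge0.
have F0 u : (0 <= \int[muY]_y (w (u, y) ^+ 2)%:E)%E.
  by apply: integral_ge0 => y _; rewrite lee_fin sqr_ge0.
apply: (@le_trans _ _
  (\int[muU]_u ((\int[muY]_y (w (u, y) ^+ 2)%:E) * (`|phi| ^+ 2)%:E))%E).
  apply: ae_ge0_le_integral => //.
  - by move=> u _; rewrite lee_fin sqr_ge0.
  - by apply/measurable_EFinP; apply: measurable_funX; exact: measurable_kernel_int.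
  - by move=> u _; rewrite mule_ge0// lee_fin sqr_ge0.
  - by apply: emeasurable_funM.
  - apply: filterS (ae_L2_section w) => u [s sw] _.
    rewrite (_ : (\int[muY]_y (w (u, y) ^+ 2)%:E)%E = (`|s| ^+ 2)%:E); last first.
      by rewrite L2_normsqE; apply: eq_integral => y _; rewrite sw.
    rewrite -EFinM lee_fin -exprMn -[leLHS]real_normK ?num_real//.
    rewrite ler_pXn2r ?nnegrE ?mulr_ge0// (le_trans _ (cauchy_schwarz_L2 s phi))//.
    by rewrite /kernel_int; under [in leRHS]eq_Rintegral do rewrite sw.
rewrite ge0_integralZr//; last by rewrite lee_fin sqr_ge0.
rewrite exprMn [in leRHS]EFinM (L2_normsqE w) -(fubini_tonelli1 (fun p => (w p ^+ 2)%:E))//.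
by move=> p; rewrite lee_fin sqr_ge0.
Qed.

Lemma kernel_int_sq_fin w phi :
  (\int[muU]_u (kernel_int w phi u ^+ 2)%:E < +oo)%E.
Proof. by rewrite (le_lt_trans (kernel_int_sq_le _ _))// ltry. Qed.

Definition kernel_op w phi : L2 muU :=
  mkL2 (measurable_kernel_int w phi) (kernel_int_sq_fin w phi).

Lemma kernel_op_norm w phi : `|kernel_op w phi| <= `|w| * `|phi|.
Proof.
rewrite -(@ler_pXn2r _ 2)// ?nnegrE ?mulr_ge0// -lee_fin L2_normsqE.
exact: kernel_int_sq_le.
Qed.

(** The linearity rules are checked at those u whose sections are square integrable, that is almost
    everywhere; hence this form up to norm zero, here and in the next two lemmas. *)
Lemma kernel_opBl w w' phi :
  `|kernel_op (w - w') phi - (kernel_op w phi - kernel_op w' phi)| = 0.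
Proof.
apply: L2_norm_ae0; apply: filterS2 (ae_L2_section w) (ae_L2_section w').
move=> u [s sw] [s' sw'].
rewrite !(L2E_add, L2E_opp) /= /kernel_int.
rewrite (_ : \int[muY]_y ((w - w') (u, y) * phi y) =
             \int[muY]_y (s y * phi y - s' y * phi y)); last first.
  by apply: eq_Rintegral => y _; rewrite L2E_add L2E_opp sw sw' mulrBl.
rewrite RintegralB//; [|exact: L2_mul_integrable..].
under [X in X - _ - _]eq_Rintegral do rewrite sw.
under [X in _ - X - _]eq_Rintegral do rewrite sw'.
by rewrite subrr.
Qed.

Lemma kernel_opDr w phi psi :
  `|kernel_op w (phi + psi) - (kernel_op w phi + kernel_op w psi)| = 0.
Proof.
apply: L2_norm_ae0; apply: filterS (ae_L2_section w) => u [s sw].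
rewrite !(L2E_add, L2E_opp) /= /kernel_int.
rewrite (_ : \int[muY]_y (w (u, y) * (phi + psi) y) =
             \int[muY]_y (s y * phi y + s y * psi y)); last first.
  by apply: eq_Rintegral => y _; rewrite L2E_add sw mulrDr.
rewrite RintegralD//; [|exact: L2_mul_integrable..].
under [X in X + _ - _]eq_Rintegral do rewrite sw.
under [X in _ + X - _]eq_Rintegral do rewrite sw.
by rewrite subrr.
Qed.

Lemma kernel_opZr w (c : R) phi :
  `|kernel_op w (c *: phi) - c *: kernel_op w phi| = 0.
Proof.
apply: L2_norm_ae0; apply: filterS (ae_L2_section w) => u [s sw].
rewrite !(L2E_add, L2E_opp, L2E_scale) /= /kernel_int.
rewrite (_ : \int[muY]_y (w (u, y) * (c *: phi) y) =
             \int[muY]_y (c * (s y * phi y))); last first.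
  by apply: eq_Rintegral => y _; rewrite L2E_scale sw mulrCA.
rewrite RintegralZl//; last exact: L2_mul_integrable.
under [X in _ * X - _]eq_Rintegral do rewrite sw.
by rewrite subrr.
Qed.

Lemma kernel_op_distr w phi psi :
  `|kernel_op w phi - kernel_op w psi| = `|kernel_op w (phi - psi)|.
Proof.
have h := kernel_opDr w (phi - psi) psi; rewrite subrK in h.
by rewrite (L2_dist_eq _ h) addrK.
Qed.

Lemma kernel_op_distl w w' phi :
  `|kernel_op w phi - kernel_op w' phi| = `|kernel_op (w - w') phi|.
Proof. by have := L2_dist_eq 0 (kernel_opBl w w' phi); rewrite !subr0. Qed.

Lemma kernel_op_dist w w' phi psi :
  `|kernel_op w phi - kernel_op w' psi| <=
  `|w - w'| * `|phi| + `|w'| * `|phi - psi|.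
Proof.
rewrite (le_trans (ler_distD (kernel_op w' phi) _ _))// lerD//.
  by rewrite kernel_op_distl kernel_op_norm.
by rewrite kernel_op_distr kernel_op_norm.
Qed.

End kernel_operator.

Section superposition.
Context d (X : measurableType d) (R : realType) (nu : {measure set X -> \bar R}).
Hypothesis nufin : (nu setT < +oo)%E.
Variables (s : R -> R) (L : R) (L0 : 0 <= L).
Hypothesis sL : forall x y, `|s x - s y| <= L * `|x - y|.

Lemma lipschitz_measurable : measurable_fun setT s.
Proof.
apply: continuous_measurable_fun => x; apply/cvgrPdist_lt => e e0.
have L1 : 0 < L + 1 by rewrite ltr_wpDl.
near=> y.
rewrite (le_lt_trans (sL _ _))// (@le_lt_trans _ _ ((L + 1) * `|x - y|))//.
  by rewrite ler_wpM2r// lerDl.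
rewrite mulrC -ltr_pdivlMr//; near: y.
apply: cvgr_dist_lt; last by rewrite divr_gt0.
exact: cvg_id.
Unshelve. all: by end_near.
Qed.

Lemma measurable_superposition (f : L2 nu) : measurable_fun setT (fun x => s (f x)).
Proof.
by apply: measurableT_comp; [exact: lipschitz_measurable|exact: measurable_L2].
Qed.

(** The Lipschitz condition dominates [s \o f] by |s 0| + L |f|, and the constant is square
    integrable because [nu] is finite. *)
Lemma superposition_fin (f : L2 nu) : (\int[nu]_x (s (f x) ^+ 2)%:E < +oo)%E.
Proof.
pose h := cstL2 nufin `|s 0|.
have mabs : measurable_fun setT (fun x => `|f x|).
  by apply: measurableT_comp => //; exact: measurable_L2.
have fabs : (\int[nu]_x ((fun x => `|f x|) x ^+ 2)%:E < +oo)%E.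
  under eq_integral do rewrite real_normK ?num_real//.
  exact: L2_norm_lt_inty.
pose k := h + L *: mkL2 mabs fabs.
apply: le_lt_trans (L2_norm_lt_inty k); apply: ge0_le_integral => //.
- by move=> x _; rewrite lee_fin sqr_ge0.
- apply/measurable_EFinP; apply: measurable_funX; exact: measurable_superposition.
- apply/measurable_EFinP; apply: measurable_funX; exact: measurable_L2.
- move=> x _; rewrite lee_fin -[leLHS]real_normK ?num_real//.
  have kE : k x = `|s 0| + L * `|f x| by [].
  rewrite kE ler_pXn2r ?nnegrE ?addr_ge0 ?mulr_ge0//.
  rewrite -[s (f x)](subrK (s 0)) addrC (le_trans (ler_normD _ _))// lerD2l.
  by rewrite (le_trans (sL _ _))// subr0.
Qed.

Definition superposition (f : L2 nu) : L2 nu :=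
  mkL2 (measurable_superposition f) (superposition_fin f).

Lemma superposition_lipschitz (f g : L2 nu) :
  `|superposition f - superposition g| <= L * `|f - g|.
Proof. by apply: le_L2_norm => //; apply: aeW => x; exact: sL. Qed.

End superposition.

(** * Bochner integrals *)

Section finite_valued.
Context d (T : measurableType d).

(** Factoring through a finite type with measurable fibres makes the notion stable under composition
    with arbitrary maps, so [V] needs no sigma-algebra. *)
Definition finite_valued (V : Type) (f : T -> V) :=
  exists (I : finType) (q : T -> I) (v : I -> V),
    (forall i, measurable (q @^-1` [set i])) /\ forall t, f t = v (q t).

Lemma finite_valued_cst V (c : V) : finite_valued (fun=> c).
Proof.
exists unit, (fun=> tt), (fun=> c); split => // -[].
by rewrite (_ : _ @^-1` _ = setT)// predeqE.
Qed.

Lemma finite_valued_comp V W (F : V -> W) f :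
  finite_valued f -> finite_valued (fun t => F (f t)).
Proof.
by move=> [I [q [v [mq fq]]]]; exists I, q, (F \o v); split => // t; rewrite fq.
Qed.

Lemma finite_valued_comp2 V V' W (F : V -> V' -> W) f f' :
  finite_valued f -> finite_valued f' -> finite_valued (fun t => F (f t) (f' t)).
Proof.
move=> [I [q [v [mq fq]]]] [I' [q' [v' [mq' fq']]]].
exists (I * I')%type, (fun t => (q t, q' t)), (fun i => F (v i.1) (v' i.2)).
split => [[i i']|t]; last by rewrite /= fq fq'.
rewrite (_ : _ @^-1` _ = q @^-1` [set i] `&` q' @^-1` [set i']).
  exact: measurableI.
by apply/seteqP; split => t /= [-> ->].
Qed.

Lemma finite_valued_mem (A : set T) : measurable A -> finite_valued (fun t => t \in A).
Proof.
move=> mA; exists bool, (fun t => t \in A), id; split => // -[].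
  by rewrite (_ : _ @^-1` _ = A)//; apply/seteqP; split => t /=; [exact: set_mem|exact: mem_set].
rewrite (_ : _ @^-1` _ = ~` A); first exact: measurableC.
apply/seteqP; split => t /=; first by move=> + At; rewrite mem_set.
by move=> nAt; apply/negbTE; apply/negP => /set_mem.
Qed.

Lemma finite_valued_preimage V (f : T -> V) (B : set V) :
  finite_valued f -> measurable (f @^-1` B).
Proof.
move=> [I [q [v [mq fq]]]].
rewrite (_ : _ @^-1` _ = \bigcup_(i in [set i | B (v i)]) q @^-1` [set i]).
  by apply: fin_bigcup_measurable => // i _; exact: mq.
apply/seteqP; split => [t /=|t [i /= Bv qti]]; last by rewrite fq qti.
by rewrite fq => Bv; exists (q t).
Qed.

Lemma finite_valued_measurable_fun d' (V : measurableType d') (f : T -> V) :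
  finite_valued f -> measurable_fun setT f.
Proof. by move=> ff _ B mB; rewrite setTI; exact: finite_valued_preimage. Qed.

Lemma finite_valued_sum (V : nmodType) n (f : 'I_n -> T -> V) :
  (forall i, finite_valued (f i)) -> finite_valued (fun t => \sum_i f i t).
Proof.
elim: n f => [|n ih] f ff.
  by rewrite (_ : (fun _ => _) = fun=> 0);
    [exact: finite_valued_cst|apply/funext => t; rewrite big_ord0].
rewrite (_ : (fun _ => _) = fun t => f ord0 t + \sum_(i < n) f (lift ord0 i) t).
  by apply: finite_valued_comp2 => //; exact: ih.
by apply/funext => t; rewrite big_ord_recl.
Qed.

End finite_valued.

Section strong_limit.
Context d (T : measurableType d) d' (X : measurableType d') (R : realType)
  (nu : {measure set X -> \bar R}).

(** Strong measurability freed from the measure: no finiteness of level sets is asked, so one proof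
    serves all the time horizons at once. *)
Definition strong_limit (g : T -> L2 nu) := exists f : nat -> T -> L2 nu,
  (forall n, finite_valued (f n)) /\
  forall t, `|g t - f n t| @[n --> \oo] --> (0 : R).

Lemma finite_valued_strong_limit g : finite_valued g -> strong_limit g.
Proof.
move=> fg; exists (fun=> g); split => // t.
by under eq_fun do rewrite subrr normr0; exact: cvg_cst.
Qed.

Lemma squeeze_norm0 (u v : nat -> R) : (forall n, 0 <= u n <= v n) ->
  v n @[n --> \oo] --> (0 : R) -> u n @[n --> \oo] --> (0 : R).
Proof.
move=> uv v0; apply: (squeeze_cvgr (f := fun=> 0) (h := v)) => //.
  exact: nearW.
exact: cvg_cst.
Qed.

Lemma strong_limitB g g' :
  strong_limit g -> strong_limit g' -> strong_limit (fun t => g t - g' t).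
Proof.
move=> [f [ff fg]] [f' [ff' fg']]; exists (fun n t => f n t - f' n t); split.
  by move=> n; exact: (finite_valued_comp2 (fun x y => x - y)).
move=> t; apply: (squeeze_norm0 (v := fun n => `|g t - f n t| + `|g' t - f' n t|)).
  move=> n; rewrite normr_ge0/=.
  rewrite (_ : g t - g' t - _ = (g t - f n t) - (g' t - f' n t)) ?ler_normB//.
  by rewrite !opprD !opprK addrACA.
by rewrite -[X in _ --> X](addr0 (0 : R)); apply: cvgD; [exact: fg|exact: fg'].
Qed.

Lemma strong_limit_norm_measurable g :
  strong_limit g -> measurable_fun setT (fun t => `|g t|).
Proof.
move=> [f [ff fg]]; apply: (@measurable_fun_cvg _ _ _ _ (fun n t => `|f n t|)).
  move=> n; apply: finite_valued_measurable_fun.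
  exact: (finite_valued_comp (fun x => `|x|)).
move=> t _; apply/cvgrPdist_le => e e0.
move/cvgrPdist_le : (fg t) => /(_ e e0); apply: filterS => n.
rewrite sub0r normrN ger0_norm ?normr_ge0// => gf.
rewrite ler_norml; apply/andP; split.
  rewrite lerBrDl lerBlDr (le_trans _ (lerD (lexx _) gf))//.
  by rewrite -[in leLHS](subrK (g t) (f n t)) addrC (le_trans (ler_normD _ _))// distrC.
rewrite lerBlDr (le_trans _ (lerD gf (lexx _)))//.
by rewrite -[in leLHS](subrK (f n t) (g t)) (le_trans (ler_normD _ _)).
Qed.

End strong_limit.

Section bochner_integral.
Context d (T : measurableType d) d' (X : measurableType d') (R : realType)
  (nu : {measure set X -> \bar R}).

Lemma strong_limit_approx (mu : {measure set T -> \bar R}) (g : T -> L2 nu) :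
  strong_limit g -> (\int[mu]_t `|g t|%:E < +oo)%E ->
  forall e : R, 0 < e -> exists2 f : T -> L2 nu,
    finite_valued f & (\int[mu]_t `|g t - f t|%:E <= e%:E)%E.
Proof.
move=> [f [ff fg]] gfin e e0.
have sg : strong_limit g by exists f.
have mg := strong_limit_norm_measurable sg.
have mf n : measurable_fun setT (fun t => `|f n t|).
  by apply: strong_limit_norm_measurable; exact: finite_valued_strong_limit.
(* Values of [f n] of norm above twice that of [g] are replaced by 0. This yields the majorant 3 |g|
   for dominated convergence, and for large n changes nothing at points where |g| is positive; where
   |g| is 0 the truncation has norm 0 as well. *)
pose A n := [set t | `|f n t| <= 2 * `|g t|].
have mA n : measurable (A n).
  rewrite (_ : A n = (fun t => 2 * `|g t| - `|f n t|) @^-1` `[0, +oo[).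
    rewrite -[X in measurable X]setTI.
    suff : measurable_fun setT (fun t => 2 * `|g t| - `|f n t|) by apply.
    by apply: measurable_funB => //; exact: measurable_funM.
  by apply/seteqP; split => t; rewrite /A/= in_itv/= andbT subr_ge0.
pose h n t : L2 nu := if t \in A n then f n t else 0.
have fh n : finite_valued (h n).
  apply: (finite_valued_comp2 (fun (b : bool) (x : L2 nu) => if b then x else 0)) => //.
  exact: finite_valued_mem.
have mgh n : measurable_fun setT (fun t => `|g t - h n t|%:E).
  apply/measurable_EFinP; apply: strong_limit_norm_measurable; apply: strong_limitB => //.
  exact: finite_valued_strong_limit.
have gh t : `|g t - h n t|%:E @[n --> \oo] --> (0 : R)%:E.
  apply: cvg_EFin; first exact: nearW.
  have [g0|g0] := eqVneq `|g t| 0.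
    have E n : `|g t - h n t| = 0.
      apply: le_anti; rewrite normr_ge0 andbT.
      rewrite (le_trans (ler_normB _ _))// g0 add0r /h.
      case: ifPn => [/set_mem|_]; last by rewrite normr0.
      by rewrite /A/= g0 mulr0.
    by under eq_fun do rewrite /= E; exact: cvg_cst.
  have gt0 : 0 < `|g t| by rewrite lt_neqAle eq_sym g0 normr_ge0.
  apply/cvgrPdist_le => r r0 /=.
  have := fg t => /cvgrPdist_le fgt.
  have := fgt _ gt0; have := fgt _ r0; apply: filterS2 => n.
  rewrite !sub0r !normrN !(ger0_norm (normr_ge0 _)) => hr hg.
  rewrite /h mem_set//= /A/=.
  rewrite -[f n t](subrK (g t)) (le_trans (ler_normD _ _))// distrC.
  by lra.
have dom n t : setT t -> (`|(`|g t - h n t|)%:E| <= (3 * `|g t|)%:E)%E.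
  move=> _; rewrite gee0_abs ?lee_fin; last exact: normr_ge0.
  rewrite (le_trans (ler_normB _ _))// /h.
  have g0 := normr_ge0 (g t).
  by case: ifPn => [/set_mem|_]; rewrite /A/= ?normr0; lra.
have ig : mu.-integrable setT (fun t => (3 * `|g t|)%:E).
  apply/integrableP; split; first exact/measurable_EFinP/measurable_funM.
  under eq_integral do rewrite gee0_abs ?lee_fin ?mulr_ge0 ?normr_ge0// EFinM.
  rewrite ge0_integralZl_EFin//; last exact/measurable_EFinP.
  - by rewrite lte_mul_pinfty.
  - by move=> t _; rewrite lee_fin normr_ge0.
have fing t : setT t -> (3 * `|g t|)%:E \is a fin_num by [].
have := dominated_cvg measurableT mgh (fun t _ => gh t) fing ig dom.
rewrite integral0 => /fine_cvgP[ifin /cvgrPdist_le/(_ e e0) ie].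
have [n _ nP] := filterI ifin ie.
have [/= nfin ne] := nP n (leqnn n); exists (h n) => //.
rewrite -(fineK nfin) lee_fin; move: ne; rewrite sub0r normrN.
exact: le_trans (ler_norm _).
Qed.

Section simple_integral.
Variable mu : {measure set T -> \bar R}.

Definition L2_ip (u v : L2 nu) : R := \int[nu]_x (u x * v x).

Lemma L2_ip_sum n (c : 'I_n -> R) (v : 'I_n -> L2 nu) (phi : L2 nu) :
  L2_ip (\sum_i c i *: v i) phi = \sum_i c i * L2_ip (v i) phi.
Proof.
elim: n c v => [|n ih] c v.
  rewrite !big_ord0 /L2_ip; under eq_Rintegral do rewrite mul0r.
  by rewrite Rintegral_cst// mul0r.
rewrite !big_ord_recl -ih /L2_ip.
rewrite -RintegralZl//; last exact: L2_mul_integrable.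
set w := \sum_(i < n) _.
have i0 : nu.-integrable setT (fun x => (c ord0 * (v ord0 x * phi x))%:E).
  apply: eq_integrable (L2_mul_integrable (c ord0 *: v ord0) phi) => // x _.
  by rewrite L2E_scale/= mulrA.
rewrite -(RintegralD measurableT i0 (L2_mul_integrable w phi)).
by apply: eq_Rintegral => x _; rewrite L2E_add L2E_scale mulrDl mulrA.
Qed.

Lemma L2_ipB (u v phi : L2 nu) : L2_ip (u - v) phi = L2_ip u phi - L2_ip v phi.
Proof.
rewrite /L2_ip -RintegralB//; [|exact: L2_mul_integrable..].
by apply: eq_Rintegral => x _; rewrite L2E_add L2E_opp mulrBl.
Qed.

Lemma L2_ip_norm (u : L2 nu) : L2_ip u u = `|u| ^+ 2.
Proof.
by apply: EFin_inj; rewrite L2_normsqE /L2_ip /Rintegral fineK//;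
  exact: (integrable_fin_num measurableT (L2_mul_integrable u u)).
Qed.

Lemma integrable_indic_lty (A : set T) : measurable A -> (mu A < +oo)%E ->
  mu.-integrable setT (fun t => (\1_A t : R)%:E).
Proof.
move=> mA Afin; apply/integrableP; split; first exact/measurable_EFinP.
under eq_integral do rewrite gee0_abs ?lee_fin//.
by rewrite integral_indic// setIT.
Qed.

Lemma sf_ip_integrable (s : simple_fun mu nu) (phi : L2 nu) :
  mu.-integrable setT (fun t => (L2_ip (sf_eval s t) phi)%:E).
Proof.
rewrite /sf_eval; under eq_fun do rewrite L2_ip_sum -sumEFin.
apply: integrable_sum => // i _.
under eq_fun do rewrite EFinM muleC.
apply: integrableZl => //; apply: integrable_indic_lty => //.
  exact: sf_measurable.
exact: sf_finite.
Qed.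

Lemma sf_ip_integral (s : simple_fun mu nu) (phi : L2 nu) :
  \int[mu]_t L2_ip (sf_eval s t) phi = L2_ip (sf_integral s) phi.
Proof.
have ii i : mu.-integrable setT (fun t => (\1_(sf_set (s := s) i) t * L2_ip (sf_val i) phi)%:E).
  under eq_fun do rewrite EFinM muleC.
  apply: integrableZl => //; apply: integrable_indic_lty => //.
    exact: sf_measurable.
  exact: sf_finite.
rewrite /sf_eval /sf_integral L2_ip_sum /Rintegral.
under eq_integral do rewrite L2_ip_sum -sumEFin.
rewrite integral_sum//.
rewrite -[RHS]/(fine (\sum_i _)%:E) -sumEFin; congr fine; apply: eq_bigr => i _.
under eq_integral do rewrite EFinM.
rewrite integralZr//; last first.
  apply: integrable_indic_lty => //; [exact: sf_measurable|exact: sf_finite].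
rewrite integral_indic//; last exact: sf_measurable.
have Afin : mu (sf_set i) \is a fin_num by rewrite ge0_fin_numE//; exact: sf_finite.
by rewrite setIT EFinM (fineK Afin).
Qed.

Lemma sf_eval_finite_valued (s : simple_fun mu nu) : finite_valued (sf_eval s).
Proof.
apply: finite_valued_sum => i.
apply: (finite_valued_comp (fun c : R => c *: sf_val i)).
apply: (finite_valued_comp (fun b : bool => b%:R : R)).
by apply: finite_valued_mem; exact: sf_measurable.
Qed.

(* Testing the difference of the two integrals against itself replaces the
   refinement of both simple functions to a common partition. *)
Lemma sf_integral_dist (s s' : simple_fun mu nu) :
  (`|sf_integral s - sf_integral s'|%:E <=
   \int[mu]_t `|sf_eval s t - sf_eval s' t|%:E)%E.
Proof.
set phi := sf_integral s - sf_integral s'.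
have [phi0|phi0] := eqVneq `|phi| 0.
  by rewrite phi0; apply: integral_ge0 => t _; rewrite lee_fin normr_ge0.
have gt0 : 0 < `|phi| by rewrite lt_neqAle eq_sym phi0 normr_ge0.
have ms : measurable_fun setT (fun t => `|sf_eval s t - sf_eval s' t|%:E).
  apply/measurable_EFinP; apply: strong_limit_norm_measurable.
  exact: strong_limitB (finite_valued_strong_limit (sf_eval_finite_valued s))
    (finite_valued_strong_limit (sf_eval_finite_valued s')).
rewrite -(@lee_pmul2r _ `|phi|%:E)// -EFinM -expr2 -L2_ip_norm {1}/phi L2_ipB.
rewrite -!sf_ip_integral.
rewrite -(RintegralB measurableT (sf_ip_integrable s phi) (sf_ip_integrable s' phi)).
under eq_Rintegral do rewrite -L2_ipB.
have ip_int : mu.-integrable setT (fun t => (L2_ip (sf_eval s t - sf_eval s' t) phi)%:E).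
  under eq_fun do rewrite L2_ipB EFinB.
  by apply: integrableB => //; exact: sf_ip_integrable.
rewrite -ge0_integralZr ?lee_fin ?normr_ge0//; last first.
  by move=> t _; rewrite lee_fin normr_ge0.
apply: (@le_trans _ _ (\int[mu]_t `|(L2_ip (sf_eval s t - sf_eval s' t) phi)%:E|)%E).
  rewrite /Rintegral fineK; last exact: (integrable_fin_num measurableT ip_int).
  apply: le_trans (le_abse_integral _ _ _) => //; first exact: lee_abs.
  exact: measurable_int ip_int.
apply: ge0_le_integral => //.
- by apply: measurableT_comp => //; exact: measurable_int ip_int.
- exact: emeasurable_funM.
- by move=> t _; rewrite -EFinM lee_fin; exact: cauchy_schwarz_L2.
Qed.

End simple_integral.
End bochner_integral.

Section bochner_compare.
Context d (T : measurableType d) d' (X : measurableType d') (R : realType)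
  (nu : {measure set X -> \bar R}).

(** Same sets and values under another measure: a single approximating sequence then serves every
    time horizon. *)
Definition sf_change (mu mu' : {measure set T -> \bar R})
    (mu'fin : (mu' setT < +oo)%E) (s : simple_fun mu nu) : simple_fun mu' nu :=
  SimpleFun (@sf_val _ _ _ _ _ mu nu s) (@sf_measurable _ _ _ _ _ mu nu s)
    (fun i => le_lt_trans (le_measure mu' (mem_set (sf_measurable i))
       (mem_set measurableT) (@subsetT _ _)) mu'fin).

Lemma finite_valued_sf_eval (mu : {measure set T -> \bar R}) (f : T -> L2 nu) :
  (mu setT < +oo)%E -> finite_valued f ->
  exists s : simple_fun mu nu, sf_eval s = f.
Proof.
move=> mufin [I [q [v [mq fq]]]].
have fin A : measurable A -> (mu A < +oo)%E.
  by move=> mA; apply: le_lt_trans mufin; rewrite le_measure ?inE.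
exists (SimpleFun (fun i : 'I_#|I| => v (enum_val i))
  (fun i => mq (enum_val i)) (fun i => fin _ (mq (enum_val i)))).
apply/funext => t; rewrite /sf_eval /= fq.
rewrite (bigD1 (enum_rank (q t)))//= big1 ?addr0.
  by rewrite enum_rankK indicE mem_set// scale1r.
move=> i iq; rewrite indicE memNset ?scale0r//= => /esym qi.
by move: iq; rewrite -qi enum_valK eqxx.
Qed.

Lemma strongly_measurable_strong_limit (mu : {measure set T -> \bar R})
  (g : T -> L2 nu) : strongly_measurable mu g -> strong_limit g.
Proof.
move=> [s sg]; exists (fun n => sf_eval (s n)); split => // n.
exact: sf_eval_finite_valued.
Qed.

Lemma bochnerL1_strong_limit (mu : {measure set T -> \bar R})
  (a : bochnerL1 mu nu) : strong_limit a.
Proof. exact: strongly_measurable_strong_limit (bochner_measurable a). Qed.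

Lemma strong_limit_strongly_measurable (mu : {measure set T -> \bar R})
  (g : T -> L2 nu) : (mu setT < +oo)%E -> strong_limit g ->
  strongly_measurable mu g.
Proof.
move=> mufin [f [ff fg]].
have /choice[s sf] n := finite_valued_sf_eval mufin (ff n).
by exists s => t; under eq_fun do rewrite sf; exact: fg.
Qed.

Lemma integral_dist_triangle (mu : {measure set T -> \bar R}) (f g h : T -> L2 nu) :
  strong_limit f -> strong_limit g -> strong_limit h ->
  (\int[mu]_t `|f t - h t|%:E <=
   \int[mu]_t `|f t - g t|%:E + \int[mu]_t `|g t - h t|%:E)%E.
Proof.
move=> sf sg sh.
have m u v : strong_limit u -> strong_limit v ->
    measurable_fun setT (fun t => (`|u t - v t : L2 nu|)%:E).
  move=> su sv; apply/measurable_EFinP/strong_limit_norm_measurable.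
  exact: strong_limitB.
have n0 (u v : T -> L2 nu) t : setT t -> (0 <= `|u t - v t|%:E)%E.
  by move=> _; rewrite lee_fin normr_ge0.
rewrite -ge0_integralD//; [|exact: n0|exact: m|exact: n0|exact: m].
apply: ge0_le_integral => //; [exact: n0|exact: m| |].
  by apply: emeasurable_funD; exact: m.
by move=> t _; rewrite -EFinD lee_fin ler_distD.
Qed.

(** Both sides are approximated by simple functions, at the price of four errors [e / 4]: two in the
    integrands and two in the integrals. With [g = g'] it gives uniqueness up to norm zero, with
    [g' = 0] the norm bound. *)
Lemma is_bochner_integral_dist (mu : {measure set T -> \bar R})
  (g g' : T -> L2 nu) (v v' : L2 nu) :
  is_bochner_integral mu g v -> is_bochner_integral mu g' v' ->
  (`|v - v'|%:E <= \int[mu]_t `|g t - g' t|%:E)%E.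
Proof.
move=> [/strongly_measurable_strong_limit mg [s [sg sv]]].
move=> [/strongly_measurable_strong_limit mg' [s' [sg' sv']]].
apply/lee_addgt0Pr => e e0.
have e4 : 0 < e / 4 by rewrite divr_gt0.
have int_small (u : nat -> \bar R) : u n @[n --> \oo] --> 0%E ->
    \forall n \near \oo, (u n <= (e / 4)%:E)%E.
  move=> /fine_cvgP[uf /cvgrPdist_le/(_ _ e4)]; apply: filterS2 uf => n uf.
  rewrite sub0r normrN => ue; rewrite -(fineK uf) lee_fin.
  exact: le_trans (ler_norm _) ue.
have real_small (u : nat -> R) : u n @[n --> \oo] --> (0 : R) ->
    \forall n \near \oo, u n <= e / 4.
  move=> /cvgrPdist_le/(_ _ e4); apply: filterS => n.
  by rewrite sub0r normrN; exact: le_trans (ler_norm _).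
have [n _ nP] := filterI (filterI (int_small _ sg) (int_small _ sg'))
  (filterI (real_small _ sv) (real_small _ sv')).
have [[/= h1 h2] [/= h3 h4]] := nP n (leqnn n).
have ms k := finite_valued_strong_limit (sf_eval_finite_valued (s k)).
have ms' k := finite_valued_strong_limit (sf_eval_finite_valued (s' k)).
have h5 : (`|sf_integral (s n) - sf_integral (s' n)|%:E <=
    (e / 4)%:E + (\int[mu]_t `|g t - g' t|%:E + (e / 4)%:E))%E.
  apply: le_trans (sf_integral_dist _ _) _.
  apply: le_trans (integral_dist_triangle mu (ms n) mg (ms' n)) _.
  apply: leeD; first by under eq_integral do rewrite distrC.
  apply: le_trans (integral_dist_triangle mu mg mg' (ms' n)) _.
  by apply: leeD.
apply: (@le_trans _ _ ((e / 4)%:E +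
   (`|sf_integral (s n) - sf_integral (s' n)|%:E + (e / 4)%:E))%E).
  rewrite -!EFinD lee_fin (le_trans (ler_distD (sf_integral (s n)) _ _))// lerD//.
  by rewrite (le_trans (ler_distD (sf_integral (s' n)) _ _))// lerD// distrC.
apply: (@le_trans _ _ ((e / 4)%:E + (((e / 4)%:E +
   (\int[mu]_t `|g t - g' t|%:E + (e / 4)%:E)) + (e / 4)%:E))%E).
  by apply: leeD => //; apply: leeD.
have : (0 <= \int[mu]_t `|g t - g' t|%:E)%E.
  by apply: integral_ge0 => t _; rewrite lee_fin normr_ge0.
case: (\int[mu]_t `|g t - g' t|%:E)%E => [r|_|//]; last by rewrite leey.
by move=> _; rewrite -!EFinD lee_fin; lra.
Qed.

Lemma is_bochner_integral_eq (mu : {measure set T -> \bar R})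
  (g : T -> L2 nu) (v v' : L2 nu) : `|v - v'| = 0 ->
  is_bochner_integral mu g v -> is_bochner_integral mu g v'.
Proof.
move=> vv' [mg [s [sg sv]]]; split => //; exists s; split => //.
by under eq_fun do rewrite -(L2_dist_eq _ vv').
Qed.

Lemma is_bochner_integral0 (mu : {measure set T -> \bar R}) :
  is_bochner_integral mu (fun=> 0 : L2 nu) 0.
Proof.
pose s : simple_fun mu nu := @SimpleFun _ _ _ _ _ mu nu 0 (fun=> set0) (fun=> 0)
  (fun i => measurable0) (fun i => ltac:(by rewrite measure0)).
have s0 t : sf_eval s t = 0 by rewrite /sf_eval big_ord0.
split.
  by exists (fun=> s) => t; under eq_fun do rewrite s0 subrr normr0; exact: cvg_cst.
exists (fun=> s); split.
  under eq_fun do under eq_integral do rewrite s0 subrr normr0.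
  by rewrite integral0; exact: cvg_cst.
by rewrite /sf_integral big_ord0 subrr normr0; exact: cvg_cst.
Qed.

End bochner_compare.

(** * Primitives in time of Bochner integrable functions *)

Section time_primitive.
Context {R : realType}.
Local Notation tm := (@time_measure R).

Lemma time_measureE t A : tm t A = lebesgue_measure (A `&` `]0, t[%classic).
Proof. by []. Qed.

Lemma time_measure_fin t : (tm t setT < +oo)%E.
Proof.
rewrite time_measureE setTI lebesgue_measure_itv/=; case: ifP => // _.
by rewrite ltry.
Qed.

Lemma le_time_measure t t' A : t <= t' -> measurable A -> (tm t A <= tm t' A)%E.
Proof.
move=> tt' mA; rewrite !time_measureE le_measure ?inE//; try exact: measurableI.
by apply: setIS => x /=; rewrite !in_itv/= => /andP[-> /lt_le_trans]; apply.
Qed.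

Lemma time_measure_lipschitz t t' A : t <= t' -> measurable A ->
  (tm t' A <= tm t A + (t' - t)%:E)%E.
Proof.
move=> tt' mA; rewrite !time_measureE.
have -> : (t' - t)%:E = lebesgue_measure `[t, t'[%classic.
  rewrite lebesgue_measure_itv/= lte_fin; case: ltP => // t't.
  by congr EFin; apply/eqP; rewrite subr_eq0 eq_le t't.
apply: le_trans (measureU2 _ _ _) => //; last exact: measurableI.
rewrite le_measure ?inE//; [exact: measurableI| |].
  by apply: measurableU => //; exact: measurableI.
move=> x [Ax]; rewrite /= !in_itv/= => /andP[x0 xt'].
have [xt|tx] := ltP x t; [left|right].
  by split => //=; rewrite ?in_itv/= x0.
exact: xt'.
Qed.

Lemma le_integral_time_measure t t' (f : measurableTypeR R -> \bar R) : t <= t' ->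
  (forall s, (0 <= f s)%E) -> measurable_fun setT f ->
  (\int[tm t]_s f s <= \int[tm t']_s f s)%E.
Proof.
move=> tt' f0 mf; apply: ge0_le_measure_integral => // S mS.
exact: le_time_measure.
Qed.

Context d (X : measurableType d) (nu : {measure set X -> \bar R}).
Hypothesis nufin : (nu setT < +oo)%E.

(** Required on the whole line: horizons are cut off as [Num.min t T], so functions of time are
    defined everywhere and the interval [[0, T]] enters only when the solution is restricted to
    it. *)
Definition unif_cont (f : R -> L2 nu) := forall e : R, 0 < e ->
  exists2 dl : R, 0 < dl & forall t t', `|t - t'| < dl -> `|f t - f t'| < e.

Lemma time_measure_min_dist (T t t' : R) (A : set (measurableTypeR R)) :
  measurable A ->
  `|fine (tm (Num.min t T) A) - fine (tm (Num.min t' T) A)| <= `|t - t'|.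
Proof.
move=> mA.
have fin u : tm u A \is a fin_num.
  rewrite ge0_fin_numE//; apply: le_lt_trans (time_measure_fin u).
  by rewrite le_measure ?inE.
wlog tt' : t t' / t' <= t.
  move=> h; have [|/ltW] := leP t' t; first exact: h.
  by move=> /h; rewrite (distrC (fine _)) (distrC t).
have mm : Num.min t' T <= Num.min t T.
  by rewrite le_min !ge_min tt' lexx !orbT.
have h1 := le_time_measure mm mA.
have h2 := time_measure_lipschitz mm mA.
have h3 : Num.min t T - Num.min t' T <= t - t'.
  by rewrite /Num.min; case: ifP; case: ifP; lra.
rewrite ger0_norm; last by rewrite subr_ge0 fine_le.
rewrite ger0_norm ?subr_ge0//; apply: le_trans h3.
by rewrite lerBlDl -lee_fin EFinD !fineK.
Qed.

Lemma sf_integral_time_lipschitz (T : R) (s : simple_fun (tm T) nu) t t' :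
  `|sf_integral (sf_change (time_measure_fin (Num.min t T)) s) -
    sf_integral (sf_change (time_measure_fin (Num.min t' T)) s)| <=
  `|t - t'| * \sum_i `|sf_val (s := s) i|.
Proof.
rewrite /sf_integral -sumrB mulr_sumr (le_trans (ler_norm_sum _ _ _))// ler_sum// => i _.
rewrite -scalerBl L2_normZ ler_wpM2r ?normr_ge0// /=.
by apply: time_measure_min_dist; exact: (sf_measurable (s := s)).
Qed.

(** Integrals of simple functions are Lipschitz in the horizon. Their convergence is uniform in t,
    since the error up to [Num.min t T] is at most the error up to [T], and so uniform continuity
    survives the limit. *)
Lemma bochner_primitive (T : R) (g : R -> L2 nu) :
  strong_limit (g : measurableTypeR R -> _) ->
  (\int[tm T]_t `|g t|%:E < +oo)%E ->
  exists2 v : R -> L2 nu,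
    (forall t, is_bochner_integral (tm (Num.min t T)) (g : measurableTypeR R -> _) (v t)) &
    unif_cont v.
Proof.
move=> mg gfin.
have /choice[f fP] n : exists f : measurableTypeR R -> L2 nu,
    finite_valued f /\ (\int[tm T]_t `|g t - f t|%:E <= (1 / 2 ^+ n)%:E)%E.
  have e0 : 0 < 1 / 2 ^+ n :> R by rewrite divr_gt0.
  by have [f ? ?] := strong_limit_approx mg gfin e0; exists f.
have /choice[s sf] n := finite_valued_sf_eval (time_measure_fin T) (fP n).1.
have mf n := finite_valued_strong_limit (fP n).1.
pose st n t := sf_change (time_measure_fin (Num.min t T)) (s n).
have stE n t : sf_eval (st n t) = f n by rewrite -sf.
have mint t : Num.min t T <= T by rewrite ge_min lexx orbT.
have mn (u : measurableTypeR R -> L2 nu) : strong_limit u ->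
    measurable_fun setT (fun t => (`|u t|)%:E).
  by move=> su; apply/measurable_EFinP/strong_limit_norm_measurable.
have gf n t : (\int[tm (Num.min t T)]_t `|g t - f n t|%:E <= (1 / 2 ^+ n)%:E)%E.
  apply: le_trans (fP n).2; apply: le_integral_time_measure => //.
  - by move=> r; rewrite lee_fin normr_ge0.
  - by apply: mn; exact: strong_limitB.
have step t n : `|sf_integral (st n.+1 t) - sf_integral (st n t)| <= 2 / 2 ^+ n.
  rewrite -lee_fin (le_trans (sf_integral_dist _ _))// !stE.
  rewrite (le_trans (integral_dist_triangle _ (mf n.+1) mg (mf n)))//.
  rewrite (_ : (2 / 2 ^+ n)%:E = (1 / 2 ^+ n)%:E + (1 / 2 ^+ n)%:E)%E; last first.
    by rewrite -EFinD; congr EFin; rewrite -mulrDl.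
  apply: leeD => //; under eq_integral do rewrite distrC.
  apply: le_trans (gf _ _) _; rewrite lee_fin !div1r lef_pV2 ?posrE//.
  by rewrite ler_eXn2l// ltr1n.
have /choice[v vP] t := L2_complete nufin (step t).
have lim0 := cvg_half_pow (2 * 2 : R).
exists v => [t|e e0].
  split; first exact: strong_limit_strongly_measurable (time_measure_fin _) mg.
  exists (fun n => st n t); split; last first.
    by apply: squeeze_norm0 lim0 => n; rewrite normr_ge0 vP.
  apply: (@squeeze_cvge _ _ _ _ (fun=> 0%E) _ (fun n => (1 / 2 ^+ n)%:E)) => /=.
  - apply: nearW => n; rewrite stE gf andbT.
    by apply: integral_ge0 => r _; rewrite lee_fin normr_ge0.
  - exact: cvg_cst.
  - apply: cvg_EFin; first exact: nearW.
    apply: squeeze_norm0 lim0 => n; rewrite /= divr_ge0//= ler_wpM2r ?invr_ge0//.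
    by rewrite -natrM ler1n.
have e3 : 0 < e / 3 by rewrite divr_gt0.
move/cvgrPdist_lt : (lim0) => /(_ _ e3)[n _ nP].
have := nP n (leqnn n); rewrite /= sub0r normrN ger0_norm ?divr_ge0// => ne.
pose S := \sum_i `|sf_val (s := s n) i|.
have S0 : 0 <= S by apply: sumr_ge0 => i _; exact: normr_ge0.
have S1 : 0 < S + 1 by rewrite ltr_wpDl.
exists (e / 3 / (S + 1)); first by rewrite divr_gt0.
move=> t t' tt'.
have h : `|sf_integral (st n t) - sf_integral (st n t')| < e / 3.
  rewrite (le_lt_trans (sf_integral_time_lipschitz (s n) t t'))//.
  rewrite (@le_lt_trans _ _ (`|t - t'| * (S + 1)))//.
    by rewrite ler_wpM2l// lerDl.
  by rewrite -ltr_pdivlMr.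
rewrite (le_lt_trans (ler_distD (sf_integral (st n t)) _ _))//.
rewrite (_ : e = e / 3 + (e / 3 + e / 3)); last by field.
rewrite ltrD ?(le_lt_trans (vP t n))//.
rewrite (le_lt_trans (ler_distD (sf_integral (st n t')) _ _))// ltrD//.
by rewrite distrC (le_lt_trans (vP t' n)).
Qed.

End time_primitive.

(** * The right-hand side of the equation *)

Section grid.
Context {R : realType}.

(** For |t| < n + 1 this rounds t down to a mesh of width 1 / (n + 1), by counting the nodes that
    are at most t. As a sum of indicators of half-lines it is finite-valued at once. *)
Let grid (n : nat) (t : R) : R :=
  \sum_(i < 2 * n.+1 * n.+1)
    (((t : measurableTypeR R) \in `[i.+1%:R / n.+1%:R - n.+1%:R, +oo[%classic)%:R / n.+1%:R)
  - n.+1%:R.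

Let grid_finite_valued n : finite_valued (grid n : measurableTypeR R -> R).
Proof.
apply: (finite_valued_comp (fun x => x - n.+1%:R)).
apply: finite_valued_sum => i.
apply: (finite_valued_comp (fun b : bool => b%:R / n.+1%:R : R)).
exact: finite_valued_mem.
Qed.

Let grid_dist n t : `|t| < n.+1%:R -> `|t - grid n t| <= n.+1%:R^-1.
Proof.
move=> tn; set m : R := n.+1%:R in tn *.
have m0 : 0 < m by rewrite ltr0n.
have /andP[t1 t2] : - m < t < m by rewrite -ltr_norml.
pose x := (t + m) * m.
have x0 : 0 <= x by rewrite mulr_ge0 ?(ltW m0)//; lra.
have xm : (Num.truncn x <= 2 * n.+1 * n.+1)%N.
  rewrite truncn_le_nat (@lt_trans _ _ (2 * n.+1 * n.+1)%:R)//; last by rewrite ltr_nat.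
  by rewrite !natrM -/m /x ltr_pM2r//; lra.
have gE : grid n t = (Num.truncn x)%:R / m - m.
  rewrite /grid -/m; congr (_ - _); rewrite -mulr_suml; congr (_ / _).
  rewrite -natr_sum; congr (_ %:R).
  rewrite (eq_bigr (fun i : 'I__ => if (i < Num.truncn x)%N then 1 else 0)%N); last first.
    move=> i _; rewrite truncn_gt_nat.
    rewrite -[LHS]/(nat_of_bool _); have -> :
      ((t : measurableTypeR R) \in `[i.+1%:R / m - m, +oo[%classic) = (i.+1%:R <= x).
      rewrite -[RHS]/(_ <= _) /x -ler_pdivrMr//; apply/idP/idP.
        by move/set_mem; rewrite /= in_itv/= andbT lerBlDr.
      by move=> h; apply: mem_set; rewrite /= in_itv/= andbT lerBlDr.
    by case: ifP.
  rewrite -big_mkcond/= -(big_ord_widen _ (fun=> 1%N) xm) sum_nat_const card_ord.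
  by rewrite muln1.
have /andP[h1 h2] := truncn_itv x0.
have xt : x / m = t + m by rewrite /x mulfK// gt_eqF.
rewrite gE (_ : t - _ = (x - (Num.truncn x)%:R) / m); last by rewrite mulrBl xt; ring.
rewrite ger0_norm; last by rewrite divr_ge0 ?subr_ge0// ltW.
rewrite ler_pdivrMr// mulVf ?gt_eqF//.
by move: h2; rewrite -natr1; lra.
Qed.

Context d (X : measurableType d) (nu : {measure set X -> \bar R}).

Lemma unif_cont_strong_limit (f : R -> L2 nu) :
  unif_cont f -> strong_limit (f : measurableTypeR R -> L2 nu).
Proof.
move=> cf; exists (fun n t => f (grid n t)); split.
  by move=> n; exact: (finite_valued_comp f (grid_finite_valued n)).
move=> t; apply/cvgrPdist_lt => e /cf[dl dl0 fdl].
near=> n; rewrite sub0r normrN ger0_norm ?normr_ge0//; apply: fdl.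
apply: (@le_lt_trans _ _ n.+1%:R^-1); last first.
  by near: n; exact: (near_infty_natSinv_lt (PosNum dl0)).
apply: grid_dist; apply: (@lt_trans _ _ n%:R); last by rewrite ltr_nat.
by near: n; exact: nbhs_infty_gtr.
Unshelve. all: by end_near.
Qed.

End grid.

Section right_hand_side.
Context d (X : measurableType d) (R : realType)
  (nu : {sigma_finite_measure set X -> \bar R}).
Hypothesis nufin : (nu setT < +oo)%E.
Variables (s : R -> R) (L : R) (L0 : 0 <= L).
Hypothesis sL : forall x y, `|s x - s y| <= L * `|x - y|.

Definition rhs (a : L2 nu) (b : L2 (nu \x nu)%E) (f : L2 nu) : L2 nu :=
  superposition nufin L0 sL (a - kernel_op b f).

(** Asymmetric on purpose: [f - f'] is weighted by the second kernel, which the stability estimate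
    takes to be the reference one. *)
Lemma rhs_dist a b f a' b' f' : `|rhs a b f - rhs a' b' f'| <=
  L * (`|a - a'| + (`|b - b'| * `|f| + `|b'| * `|f - f'|)).
Proof.
rewrite (le_trans (superposition_lipschitz _ _ _ _ _))// ler_wpM2l//.
rewrite (_ : a - _ - _ = (a - a') - (kernel_op b f - kernel_op b' f')); last first.
  by rewrite !opprD !opprK addrACA.
by rewrite (le_trans (ler_normB _ _))// lerD2l kernel_op_dist.
Qed.

Lemma rhs_norm a b f :
  `|rhs a b f| <= `|rhs 0 0 0| + L * (`|a| + `|b| * `|f|).
Proof.
rewrite -[rhs a b f](subrK (rhs 0 0 0)) addrC (le_trans (ler_normD _ _))//.
by rewrite lerD2l (le_trans (rhs_dist _ _ _ _ _ _))// !subr0 normr0 mul0r addr0.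
Qed.

Lemma rhs_strong_limit d' (T : measurableType d') (a : T -> L2 nu)
    (b : T -> L2 (nu \x nu)%E) (f : T -> L2 nu) :
  strong_limit a -> strong_limit b -> strong_limit f ->
  strong_limit (fun t => rhs (a t) (b t) (f t)).
Proof.
move=> [an [fa la]] [bn [fb lb]] [fn [ff lf]].
exists (fun n t => rhs (an n t) (bn n t) (fn n t)); split.
  move=> n; have h := finite_valued_comp2 pair (fa n) (fb n).
  exact: (finite_valued_comp2 (fun ab v => rhs ab.1 ab.2 v) h (ff n)).
move=> t.
apply: (@squeeze_norm0 _ _ (fun n => L * (`|a t - an n t| +
  (`|b t - bn n t| * `|f t| + (`|b t| + `|b t - bn n t|) * `|f t - fn n t|)))).
  move=> n; rewrite normr_ge0/= (le_trans (rhs_dist _ _ _ _ _ _))//.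
  rewrite ler_wpM2l// lerD2l lerD2l ler_wpM2r//.
  by rewrite -{1}(subrK (b t) (bn n t)) addrC (le_trans (ler_normD _ _))// distrC.
have E : (0 : R) = L * (0 + (0 * `|f t| + (`|b t| + 0) * 0)) by ring.
rewrite [X in _ --> X]E.
apply: cvgM; first exact: cvg_cst.
apply: cvgD; first exact: la.
apply: cvgD; first by apply: cvgM; [exact: lb|exact: cvg_cst].
by apply: cvgM; [apply: cvgD; [exact: cvg_cst|exact: lb]|exact: lf].
Qed.

End right_hand_side.

(** * Existence and stability of solutions *)

Section bielecki.
Context {R : realType}.
Local Notation tm := (@time_measure R).

Lemma ae_time_measure t : {ae tm t, forall s : measurableTypeR R, 0 < s < t}.
Proof.
exists (~` `]0, t[%classic); split.
- by apply: measurableC; exact: measurable_itv.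
- by rewrite time_measureE setICl measure0.
- by move=> s /=; rewrite in_itv/=.
Qed.

Lemma integral_time_measure t (f : measurableTypeR R -> \bar R) :
  (forall s, (0 <= f s)%E) -> measurable_fun setT f ->
  (\int[tm t]_s f s = \int[lebesgue_measure]_(s in `]0%R, t[) f s)%E.
Proof.
move=> f0 mf.
have mD : measurable (`]0, t[%classic : set (measurableTypeR R)) by exact: measurable_itv.
transitivity (\int[tm t]_(s in `]0%R, t[) f s)%E.
  rewrite [RHS]integral_mkcond; apply: ae_eq_integral => //.
    by apply/(measurable_restrictT _ mD); exact: measurable_funTS.
  apply: filterS (ae_time_measure t) => s st _.
  by rewrite patchE mem_set//= in_itv.
apply: eq_measure_integral => A mA AD.
by rewrite time_measureE setIidl.
Qed.

Lemma integral_time_measure_expR (lam t : R) : 0 < lam ->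
  (\int[tm t]_s (expR (lam * s))%:E <= (expR (lam * t) / lam)%:E)%E.
Proof.
move=> lam0.
have mE : measurable_fun setT (fun s : measurableTypeR R => expR (lam * s)).
  by apply: measurableT_comp => //; exact: measurable_funM.
have E0 s : (0 <= (expR (lam * s))%:E)%E by rewrite lee_fin expR_ge0.
rewrite integral_time_measure//; last exact/measurable_EFinP.
have [t0|t0] := leP t 0.
  rewrite set_itv_ge ?bnd_simp -?leNgt// integral_set0 lee_fin.
  by rewrite divr_ge0 ?expR_ge0// ltW.
apply: (@le_trans _ _ (\int[lebesgue_measure]_(s in `[0%R, t]) (expR (lam * s))%:E)%E).
  apply: ge0_subset_integral => //; last exact: subset_itv_oo_cc.
  by apply: measurable_funTS; exact/measurable_EFinP.
pose F (s : R) := expR (lam * s) / lam.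
have dF (x : R) : is_derive x 1 F (expR (lam * x)).
  rewrite /F; apply: is_derive_eq.
  by rewrite /GRing.scale/=; field; rewrite gt_eqF.
have cf : continuous (fun s : R => expR (lam * s)).
  move=> x; apply: continuous_comp; last exact: continuous_expR.
  by apply: cvgM; [exact: cvg_cst|exact: cvg_id].
have cF : continuous F.
  by move=> x; apply/differentiable_continuous/derivable1_diffP; case: (dF x).
rewrite (continuous_FTC2 (F := F) t0).
- rewrite -EFinB lee_fin /F lerBlDr lerDl.
  by rewrite divr_ge0 ?expR_ge0// ltW.
- exact: continuous_subspaceT.
- split; [by move=> x _; case: (dF x)| |].
    exact: cvg_at_right_filter (cF 0).
  exact: cvg_at_left_filter (cF t).
- by move=> x _; rewrite derive1E; case: (dF x).
Qed.

(* [beta] is split into a bounded part, which the weight [expR (lam * t)]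
   makes small for large [lam], and a part of small integral. *)
Lemma bielecki (T : R) (beta : R -> R) (c : R) : 0 < c ->
  (forall s, 0 <= beta s) ->
  measurable_fun setT (beta : measurableTypeR R -> R) ->
  (\int[tm T]_s (beta s)%:E < +oo)%E ->
  exists2 lam : R, 0 < lam & forall t, t <= T ->
    (\int[tm t]_s (beta s * expR (lam * s))%:E <= (c * expR (lam * t))%:E)%E.
Proof.
move=> c0 b0 mb bfin.
pose r k (s : measurableTypeR R) := beta s - Num.min (beta s) k%:R.
have r0 k s : 0 <= r k s by rewrite subr_ge0 ge_min lexx.
have mr k : measurable_fun setT (r k).
  by apply: measurable_funB => //; exact: measurable_minr.
have c2 : 0 < c / 2 by rewrite divr_gt0.
(* Truncations at growing levels exhaust [beta], so the remainder has small integral by dominated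
   convergence. The successor keeps the level [K] positive. *)
have [k kP] : exists k, (\int[tm T]_s (r k.+1 s)%:E <= (c / 2)%:E)%E.
  have mr' k : measurable_fun setT (fun s => (r k s)%:E) by exact/measurable_EFinP.
  have cr (s : measurableTypeR R) : setT s -> (r k s)%:E @[k --> \oo] --> (0 : R)%:E.
    move=> _; apply: (@cvg_near_cst _ _ _ _ _ _); near=> k.
    rewrite /r min_l ?subrr//; near: k; exact: nbhs_infty_ger.
  have ib : (tm T).-integrable setT (fun s => (beta s)%:E).
    apply/integrableP; split; first exact/measurable_EFinP.
    by under eq_integral do rewrite gee0_abs ?lee_fin ?b0//.
  have dom k (s : measurableTypeR R) : setT s -> (`|(r k s)%:E| <= (beta s)%:E)%E.
    move=> _; rewrite gee0_abs ?lee_fin// /r lerBlDr lerDl le_min b0.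
    by rewrite ler0n.
  have fin s : setT s -> (beta s)%:E \is a fin_num by [].
  have := dominated_cvg measurableT mr' cr fin ib dom.
  rewrite integral0 => /fine_cvgP[ifin /cvgrPdist_le/(_ _ c2) ie].
  have [n _ nP] := filterI ifin ie.
  have [/= nfin ne] := nP n.+1 (leqnSn n); exists n.
  rewrite -(fineK nfin) lee_fin; move: ne; rewrite sub0r normrN.
  exact: le_trans (ler_norm _).
pose K : R := k.+1%:R.
have K0 : 0 < K by rewrite ltr0n.
(* The bounded part contributes at most [K * expR (lam * t) / lam]; this [lam] makes it half of the
   target, the remainder being the other half. *)
exists (2 * K / c) => [|t tT]; first by rewrite divr_gt0// mulr_gt0.
set lam := 2 * K / c.
have lam0 : 0 < lam by rewrite divr_gt0// mulr_gt0.
have mE : measurable_fun setT (fun s : measurableTypeR R => expR (lam * s)).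
  by apply: measurableT_comp => //; exact: measurable_funM.
have m1 : measurable_fun setT (fun s : measurableTypeR R => (expR (lam * t) * r k.+1 s)%:E).
  by apply/measurable_EFinP; exact: measurable_funM.
have m2 : measurable_fun setT (fun s : measurableTypeR R => (K * expR (lam * s))%:E).
  by apply/measurable_EFinP; exact: measurable_funM.
have n1 s : (0 <= (expR (lam * t) * r k.+1 s)%:E)%E.
  by rewrite lee_fin mulr_ge0// expR_ge0.
have n2 s : (0 <= (K * expR (lam * s))%:E)%E.
  by rewrite lee_fin mulr_ge0 ?expR_ge0 ?ltW.
apply: (@le_trans _ _ (\int[tm t]_s ((expR (lam * t) * r k.+1 s)%:E +
                                    (K * expR (lam * s))%:E))%E).
  apply: ae_ge0_le_integral => //.
  - by move=> s _; rewrite lee_fin mulr_ge0// expR_ge0.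
  - by apply/measurable_EFinP; exact: measurable_funM.
  - by move=> s _; rewrite adde_ge0.
  - exact: emeasurable_funD.
  - apply: filterS (ae_time_measure t) => s /andP[s0 st] _.
    rewrite -EFinD lee_fin.
    have h1 : expR (lam * s) <= expR (lam * t) by rewrite ler_expR ler_pM2l// ltW.
    have h2 : Num.min (beta s) K <= K by rewrite ge_min lexx orbT.
    rewrite -[beta s](subrK (Num.min (beta s) K)) mulrDl lerD//.
      by rewrite mulrC ler_wpM2r// r0.
    by rewrite ler_wpM2r// expR_ge0.
rewrite ge0_integralD//.
rewrite (_ : c * expR (lam * t) =
  expR (lam * t) * (c / 2) + K * (expR (lam * t) / lam)); last first.
  by rewrite /lam; field; rewrite !gt_eqF.
rewrite EFinD; apply: leeD.
  under eq_integral do rewrite EFinM.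
  rewrite ge0_integralZl_EFin ?expR_ge0//.
  - rewrite EFinM lee_pmul2l ?lte_fin ?expR_gt0//.
    apply: le_trans kP; apply: le_integral_time_measure => //.
    + by move=> s; rewrite lee_fin.
    + exact/measurable_EFinP.
  - by move=> s _; rewrite lee_fin.
  - exact/measurable_EFinP.
under eq_integral do rewrite EFinM.
rewrite ge0_integralZl_EFin ?(ltW K0)//; last exact/measurable_EFinP.
by rewrite EFinM lee_pmul2l// integral_time_measure_expR.
Unshelve. all: by end_near.
Qed.

End bielecki.

Section cauchy_problem.
Context d (X : measurableType d) (R : realType)
  (nu : {sigma_finite_measure set X -> \bar R}).
Hypothesis nufin : (nu setT < +oo)%E.
Variables (s : R -> R) (L : R) (L0 : 0 <= L).
Hypothesis sL : forall x y, `|s x - s y| <= L * `|x - y|.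
Local Notation tm := (@time_measure R).
Local Notation rhs := (rhs nufin L0 sL).
Variables (T : R).
Local Notation bL1 := (bochnerL1 (tm T) nu).
Local Notation bL1K := (bochnerL1 (tm T) (nu \x nu)%E).

Lemma time_measure_le0 t (f : measurableTypeR R -> \bar R) : t <= 0 ->
  (forall r, (0 <= f r)%E) -> measurable_fun setT f ->
  (\int[tm t]_r f r = 0)%E.
Proof.
move=> t0 f0 mf; rewrite integral_time_measure//.
by rewrite set_itv_ge ?bnd_simp -?leNgt// integral_set0.
Qed.

Section existence.
Variables (a : bL1) (b : bL1K) (fI : L2 nu).

Let mea (f : measurableTypeR R -> L2 nu) : strong_limit f ->
  measurable_fun setT (fun t => (`|f t|)%:E).
Proof. by move=> mf; apply/measurable_EFinP/strong_limit_norm_measurable. Qed.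

Let beta t := L * `|b t|.

Let beta0 t : 0 <= beta t. Proof. by rewrite mulr_ge0// normr_ge0. Qed.

Let mbeta : measurable_fun setT (beta : measurableTypeR R -> R).
Proof.
apply: measurable_funM => //.
exact: strong_limit_norm_measurable (bochnerL1_strong_limit b).
Qed.

Let beta_fin : (\int[tm T]_t (beta t)%:E < +oo)%E.
Proof.
under eq_integral do rewrite EFinM.
rewrite ge0_integralZl_EFin//.
- by rewrite lte_mul_pinfty// ?lee_fin//; exact: bochner_integrable.
- by move=> t _; rewrite lee_fin normr_ge0.
- apply/measurable_EFinP.
  exact: strong_limit_norm_measurable (bochnerL1_strong_limit b).
Qed.

Let G (f : R -> L2 nu) (t : measurableTypeR R) : L2 nu := rhs (a t) (b t) (f t).

(** The class preserved by a Picard step: uniform continuity makes [G f] strongly measurable, and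
    boundedness makes its norm integrable. *)
Let adm (f : R -> L2 nu) := unif_cont f /\ exists M, forall t, `|f t| <= M.

Let G_strong_limit f : adm f -> strong_limit (G f).
Proof.
move=> [cf _]; apply: rhs_strong_limit.
- exact: bochnerL1_strong_limit.
- exact: bochnerL1_strong_limit.
- exact: unif_cont_strong_limit.
Qed.

Let G_fin f : adm f -> (\int[tm T]_t `|G f t|%:E < +oo)%E.
Proof.
move=> af; have mG := mea (G_strong_limit af); have [cf [M fM]] := af.
have M0 : 0 <= M by exact: le_trans (normr_ge0 _) (fM 0).
have ma : measurable_fun setT (fun t => (L * `|a t|)%:E).
  apply/measurable_EFinP; apply: measurable_funM => //.
  exact: strong_limit_norm_measurable (bochnerL1_strong_limit a).
have mb : measurable_fun setT (fun t : measurableTypeR R => (beta t * M)%:E).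
  by apply/measurable_EFinP; exact: measurable_funM.
apply: (@le_lt_trans _ _ (\int[tm T]_t
  ((`|rhs 0 0 0|%:E + (L * `|a t|)%:E) + (beta t * M)%:E))%E).
  apply: ge0_le_integral => //.
  - by move=> t _; rewrite lee_fin normr_ge0.
  - by apply: emeasurable_funD => //; exact: emeasurable_funD.
  - move=> t _; rewrite -!EFinD lee_fin (le_trans (rhs_norm _ _ _ _ _ _))//.
    by rewrite mulrDr addrA lerD2l mulrA ler_wpM2l ?mulr_ge0 ?normr_ge0.
rewrite ge0_integralD//; last 3 first.
- by move=> t _; rewrite adde_ge0// lee_fin ?mulr_ge0 ?normr_ge0.
- exact: emeasurable_funD.
- by move=> t _; rewrite lee_fin mulr_ge0.
rewrite ge0_integralD//; last 2 first.
- by move=> t _; rewrite lee_fin normr_ge0.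
- by move=> t _; rewrite lee_fin mulr_ge0// normr_ge0.
apply: lte_add_pinfty; first apply: lte_add_pinfty.
- rewrite (_ : (fun=> _) = cst `|rhs 0 0 0|%:E)// integral_cst//.
  rewrite lte_mul_pinfty ?lee_fin ?normr_ge0//.
  exact: time_measure_fin.
- under eq_integral do rewrite EFinM.
  rewrite ge0_integralZl_EFin//.
  + by rewrite lte_mul_pinfty// ?lee_fin//; exact: bochner_integrable.
  + by move=> t _; rewrite lee_fin normr_ge0.
  + apply/measurable_EFinP.
    exact: strong_limit_norm_measurable (bochnerL1_strong_limit a).
- under eq_integral do rewrite EFinM.
  rewrite ge0_integralZr//; last 2 first.
  + exact/measurable_EFinP.
  + by move=> t _; rewrite lee_fin.
  by rewrite muleC lte_mul_pinfty// lee_fin.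
Qed.

Let picard_step f : adm f -> exists f', adm f' /\
  forall t, is_bochner_integral (tm (Num.min t T)) (G f) (f' t - fI).
Proof.
move=> af; have [v vP cv] := bochner_primitive nufin (G_strong_limit af) (G_fin af).
exists (fun t => fI + v t); split; last by move=> t; rewrite addrC addKr.
split.
  move=> e /cv[dl dl0 h]; exists dl => // t t' /h.
  by rewrite opprD addrACA subrr add0r.
pose C := fine (\int[tm T]_t `|G f t|%:E).
have CE : (C%:E = \int[tm T]_t `|G f t|%:E)%E.
  rewrite fineK// ge0_fin_numE; first exact: (G_fin af).
  by apply: integral_ge0 => r _; rewrite lee_fin normr_ge0.
exists (`|fI| + C) => t.
rewrite (le_trans (ler_normD _ _))// lerD2l -lee_fin CE.
have := is_bochner_integral_dist (vP t) (is_bochner_integral0 _ _).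
rewrite subr0; under eq_integral do rewrite subr0.
move/le_trans; apply; apply: le_integral_time_measure.
- by rewrite ge_min lexx orbT.
- by move=> r; rewrite lee_fin normr_ge0.
- exact: mea (G_strong_limit af).
Qed.

Let G_dist f f' t : `|G f t - G f' t| <= beta t * `|f t - f' t|.
Proof.
rewrite (le_trans (rhs_dist _ _ _ _ _ _ _ _ _))//.
by rewrite !subrr !normr0 mul0r !add0r mulrA.
Qed.

Lemma solution_exists : exists f : R -> L2 nu, unif_cont f /\
  forall t, is_bochner_integral (tm (Num.min t T))
    (fun r : measurableTypeR R => rhs (a r) (b r) (f r)) (f t - fI).
Proof.
(* Choice needs a map defined on all functions; outside [adm] nothing is asked of it. *)
have /choice[Phi PhiP] f : exists f', adm f -> adm f' /\
    forall t, is_bochner_integral (tm (Num.min t T)) (G f) (f' t - fI).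
  by have [/picard_step[f' ?]|naf] := pselect (adm f); [exists f'|exists f].
pose x k := iter k Phi (fun=> fI).
have ax k : adm (x k).
  elim: k => [|k ih]; last by have [] := PhiP _ ih.
  split; last by exists `|fI|.
  by move=> e e0; exists 1 => // t t' _; rewrite subrr normr0.
have xS k t : is_bochner_integral (tm (Num.min t T)) (G (x k)) (x k.+1 t - fI).
  by have [_] := PhiP _ (ax k); apply.
have minT t : Num.min t T <= T by rewrite ge_min lexx orbT.
have distG k k' t : (`|x k.+1 t - x k'.+1 t|%:E <=
    \int[tm (Num.min t T)]_r `|G (x k) r - G (x k') r|%:E)%E.
  have := is_bochner_integral_dist (xS k t) (xS k' t).
  by rewrite opprB addrA subrK.
(* The contraction factor 1/2 is the geometric rate that [L2_complete] expects. *)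
have half0 : 0 < 2^-1 :> R by [].
have [lam lam0 lamP] := bielecki half0 beta0 mbeta beta_fin.
pose C := fine (\int[tm T]_t `|G (x 0%N) t|%:E).
have C0 : 0 <= C.
  by apply: fine_ge0; apply: integral_ge0 => r _; rewrite lee_fin normr_ge0.
have CE : (C%:E = \int[tm T]_t `|G (x 0%N) t|%:E)%E.
  rewrite fineK// ge0_fin_numE; first exact: (G_fin (ax 0%N)).
  by apply: integral_ge0 => r _; rewrite lee_fin normr_ge0.
have mE : measurable_fun setT (fun r : measurableTypeR R => expR (lam * r)).
  by apply: measurableT_comp => //; exact: measurable_funM.
have step k t : `|x k.+1 t - x k t| <= C / 2 ^+ k * expR (lam * Num.min t T).
  elim: k t => [|k ih] t.
    rewrite expr0 divr1 -lee_fin.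
    have := is_bochner_integral_dist (xS 0%N t) (is_bochner_integral0 _ _).
    rewrite subr0 => /le_trans; apply; under eq_integral do rewrite subr0.
    (* For a negative horizon the weight is below 1 and could not absorb [C], but the integral
       vanishes there. *)
    have [u0|u0] := leP (Num.min t T) 0.
      rewrite time_measure_le0//.
      - by rewrite lee_fin mulr_ge0// expR_ge0.
      - by move=> r; rewrite lee_fin normr_ge0.
      - exact: mea (G_strong_limit (ax _)).
    apply: (@le_trans _ _ C%:E).
      rewrite CE; apply: le_integral_time_measure => //.
      - by move=> r; rewrite lee_fin normr_ge0.
      - exact: mea (G_strong_limit (ax _)).
    by rewrite lee_fin ler_peMr// ltW// expR_gt1 mulr_gt0.
  rewrite -lee_fin (le_trans (distG _ _ _))//.
  apply: (@le_trans _ _ (\int[tm (Num.min t T)]_r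
      ((C / 2 ^+ k)%:E * (beta r * expR (lam * r))%:E))%E).
    apply: ge0_le_integral => //.
    - by move=> r _; rewrite lee_fin normr_ge0.
    - by apply: mea; apply: strong_limitB; exact: G_strong_limit.
    - apply: emeasurable_funM => //; apply/measurable_EFinP.
      exact: measurable_funM.
    - move=> r _; rewrite -EFinM lee_fin (le_trans (G_dist _ _ _))//.
      rewrite mulrCA ler_wpM2l// (le_trans (ih r))// ler_wpM2l ?divr_ge0//.
      by rewrite ler_expR ler_pM2l// ge_min lexx.
  rewrite ge0_integralZl_EFin ?divr_ge0//.
  - rewrite (_ : C / 2 ^+ k.+1 * _ =
      C / 2 ^+ k * (2^-1 * expR (lam * Num.min t T))); last first.
      by rewrite exprS invfM; ring.
    rewrite [leRHS]EFinM lee_wpmul2l ?lee_fin ?divr_ge0//.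
    exact: lamP.
  - by move=> r _; rewrite lee_fin mulr_ge0// expR_ge0.
  - by apply/measurable_EFinP; exact: measurable_funM.
pose D := C * expR (lam * T).
have D0 : 0 <= D by rewrite mulr_ge0// expR_ge0.
have stepD t k : `|x k.+1 t - x k t| <= D / 2 ^+ k.
  rewrite (le_trans (step k t))// /D mulrAC ler_wpM2r ?invr_ge0//.
  by rewrite ler_wpM2l// ler_expR ler_pM2l.
have /choice[f fP] t := L2_complete nufin (stepD t).
have cf : unif_cont f.
  move=> e e0; have e3 : 0 < e / 3 by rewrite divr_gt0.
  have /cvgrPdist_lt/(_ _ e3)[n _ nP] := cvg_half_pow (2 * D).
  have := nP n (leqnn n); rewrite /= sub0r normrN => /(le_lt_trans (ler_norm _)) ne.
  have [/(_ _ e3)[dl dl0 h] _] := ax n; exists dl => // t t' /h tt'.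
  rewrite (_ : e = e / 3 + (e / 3 + e / 3)); last by field.
  rewrite (le_lt_trans (ler_distD (x n t) _ _))// ltrD ?(le_lt_trans (fP t n))//.
  rewrite (le_lt_trans (ler_distD (x n t') _ _))// ltrD//.
  by rewrite distrC (le_lt_trans (fP t' n)).
have af : adm f.
  split=> //; exists (`|fI| + 2 * D) => t.
  rewrite -[f t](subrK fI) addrC (le_trans (ler_normD _ _))// lerD2l.
  by rewrite (le_trans (fP t 0%N))// expr0 divr1.
(* One more Picard step from the limit gives [f'], a priori another function. Both are close to
   [x n.+1], so their distance is zero at each t, and the integral relation passes from [f'] to
   [f]. *)
have [f' [_ f'P]] := picard_step af; exists f; split=> // t.
apply: is_bochner_integral_eq (f'P t).
rewrite opprB addrA subrK.
pose B := fine (\int[tm T]_t (beta t)%:E).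
have BE : (B%:E = \int[tm T]_t (beta t)%:E)%E.
  by rewrite fineK// ge0_fin_numE//; apply: integral_ge0 => r _; rewrite lee_fin.
apply: le_anti; rewrite normr_ge0 andbT.
apply: (@le_half_pow _ _ _ (2 * D + 2 * D * B)) => n; rewrite add0r.
rewrite (le_trans (ler_distD (x n.+1 t) _ _))// addrC mulrDl lerD//.
  rewrite distrC (le_trans (fP t n.+1))// ler_wpM2l ?mulr_ge0//.
  by rewrite lef_pV2 ?posrE// ler_eXn2l// ltr1n.
have := is_bochner_integral_dist (f'P t) (xS n t).
rewrite opprB addrA subrK -lee_fin => /le_trans; apply.
apply: (@le_trans _ _ (\int[tm T]_r ((2 * D / 2 ^+ n)%:E * (beta r)%:E))%E).
  apply: (@le_trans _ _ (\int[tm T]_r `|G f r - G (x n) r|%:E)%E).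
    apply: le_integral_time_measure => //.
    - by move=> r; rewrite lee_fin normr_ge0.
    - by apply: mea; apply: strong_limitB; exact: G_strong_limit.
  apply: ge0_le_integral => //.
  - by move=> r _; rewrite lee_fin normr_ge0.
  - by apply: mea; apply: strong_limitB; exact: G_strong_limit.
  - by apply: emeasurable_funM => //; exact/measurable_EFinP.
  - move=> r _; rewrite -EFinM lee_fin (le_trans (G_dist _ _ _))// mulrC.
    by rewrite ler_wpM2r.
rewrite ge0_integralZl_EFin ?divr_ge0 ?mulr_ge0//.
- by rewrite -BE -EFinM lee_fin mulrAC.
- by move=> r _; rewrite lee_fin.
- exact/measurable_EFinP.
Qed.

End existence.

End cauchy_problem.

(** * Continuous dependence of solutions on the coefficients *)

Section stability.
Context d (X : measurableType d) (R : realType)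
  (nu : {sigma_finite_measure set X -> \bar R}).
Hypothesis nufin : (nu setT < +oo)%E.
Variables (s : R -> R) (L : R) (L0 : 0 <= L).
Hypothesis sL : forall x y, `|s x - s y| <= L * `|x - y|.
Local Notation tm := (@time_measure R).
Local Notation rhs := (rhs nufin L0 sL).
Variables (T : R) (T0 : 0 < T).
Local Notation bL1 := (bochnerL1 (tm T) nu).
Local Notation bL1K := (bochnerL1 (tm T) (nu \x nu)%E).

(** What the stability estimate uses of a solution: boundedness, which starts the iteration of a
    priori bounds, and the integral equation, its integrand being known up to norm zero at almost
    every time. *)
Definition bounded_solution (a : bL1) (b : bL1K) (fI : L2 nu) (f : R -> L2 nu) :=
  (exists M, forall t, 0 <= t <= T -> `|f t| <= M) /\
  exists2 g : R -> L2 nu,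
    {ae tm T, forall t : measurableTypeR R, `|g t - rhs (a t) (b t) (f t)| = 0} &
    forall t, 0 <= t <= T ->
      is_bochner_integral (tm t) (g : measurableTypeR R -> _) (f t - fI).

Let norm_fin d' (X' : measurableType d') (nu' : {measure set X' -> \bar R})
    (a a' : bochnerL1 (tm T) nu') :
  (\int[tm T]_t `|a t - a' t|%:E < +oo)%E.
Proof.
have sa := bochnerL1_strong_limit a.
have sa' := bochnerL1_strong_limit a'.
have s0 : strong_limit (fun _ : measurableTypeR R => 0 : L2 nu').
  exact: finite_valued_strong_limit (finite_valued_cst _ _).
apply: le_lt_trans (integral_dist_triangle (tm T) sa s0 sa') _.
apply: lte_add_pinfty.
  by under eq_integral do rewrite subr0; exact: bochner_integrable.
by under eq_integral do rewrite sub0r normrN; exact: bochner_integrable.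
Qed.

Lemma bochner_distE d' (X' : measurableType d') (nu' : {measure set X' -> \bar R})
    (a a' : bochnerL1 (tm T) nu') :
  ((bochner_dist a a')%:E = \int[tm T]_t `|a t - a' t|%:E)%E.
Proof.
rewrite /bochner_dist /Rintegral fineK// ge0_fin_numE; first exact: norm_fin.
by apply: integral_ge0 => t _; rewrite lee_fin normr_ge0.
Qed.

Lemma ae_time_measure_le t (P : measurableTypeR R -> Prop) : t <= T ->
  {ae tm T, forall r, P r} -> {ae tm t, forall r, P r}.
Proof.
move=> tT [N [mN N0 PN]]; exists N; split => //.
apply/eqP; rewrite eq_le measure_ge0 andbT -N0; exact: le_time_measure.
Qed.

Let measurable_dist d' (X' : measurableType d') (nu' : {measure set X' -> \bar R})
    (a a' : measurableTypeR R -> L2 nu') : strong_limit a -> strong_limit a' ->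
  measurable_fun setT (fun t => `|a t - a' t|).
Proof. by move=> sa sa'; apply: strong_limit_norm_measurable; exact: strong_limitB. Qed.

Section two_solutions.
Variables (a0 a : bL1) (b0 b : bL1K) (fI : L2 nu) (f0 f : R -> L2 nu).
Hypothesis (sol0 : bounded_solution a0 b0 fI f0) (sol : bounded_solution a b fI f).
Variables (M lam dl : R) (lam0 : 0 < lam).
Hypothesis f0M : forall t, 0 <= t <= T -> `|f0 t| <= M.
Hypothesis lamP : forall t, t <= T ->
    (\int[tm t]_s (L * `|b0 s| * expR (lam * s))%:E <= (4^-1 * expR (lam * t))%:E)%E.
Hypotheses (da : bochner_dist a a0 <= dl) (db : bochner_dist b b0 <= dl)
  (dl4 : L * dl <= 4^-1).

Let M0 : 0 <= M.
Proof.
by apply: le_trans (normr_ge0 (f0 0)) _; apply: f0M; rewrite lexx ltW.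
Qed.

Let dl0 : 0 <= dl.
Proof.
apply: le_trans da; rewrite -lee_fin bochner_distE.
by apply: integral_ge0 => t _; rewrite lee_fin normr_ge0.
Qed.

(* [u t = `|f t - f0 t|] satisfies [u t <= c + \int_0^t (beta + small) u], so in
   the norm weighted by [expR (- lam * t)] an a priori bound K on u improves to
   [c + K / 2]; iterating from the bound on f and f0 gives [2 * c]. *)
Lemma stability_step (K : R) : 0 <= K ->
  (forall t, 0 <= t <= T -> `|f t - f0 t| <= K * expR (lam * t)) ->
  forall t, 0 <= t <= T ->
    `|f t - f0 t| <= (L * dl * (1 + M) + K / 2) * expR (lam * t).
Proof.
move=> K0 fK t /andP[t0 tT].
have [_ [g0 g0P ig0]] := sol0; have [_ [g gP ig]] := sol.
have t0T : 0 <= t <= T by rewrite t0.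
have := is_bochner_integral_dist (ig t t0T) (ig0 t t0T).
rewrite opprB addrA subrK -lee_fin => /le_trans; apply.
have sg := strongly_measurable_strong_limit (ig t t0T).1.
have sg0 := strongly_measurable_strong_limit (ig0 t t0T).1.
have mA := measurable_dist (bochnerL1_strong_limit a) (bochnerL1_strong_limit a0).
have mB := measurable_dist (bochnerL1_strong_limit b) (bochnerL1_strong_limit b0).
have mb := strong_limit_norm_measurable (bochnerL1_strong_limit b0).
have mE : measurable_fun setT (fun r : measurableTypeR R => expR (lam * r)).
  by apply: measurableT_comp => //; exact: measurable_funM.
set e := expR (lam * t).
have e1 : 1 <= e.
  by rewrite -[1]expR0 ler_expR mulr_ge0// ltW.
have e0 : 0 <= e by exact: le_trans e1.
(* The integrand splits in three. In [hA] and [hB] the factor [a - a0] or [b - b0] is small, so the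
   crude bound [M + K * e] on f suffices; [hb] carries the reference kernel and keeps the
   exponential weight that [lamP] needs. *)
pose hA (r : measurableTypeR R) : R := L * `|a r - a0 r|.
pose hB (r : measurableTypeR R) : R := L * (M + K * e) * `|b r - b0 r|.
pose hb (r : measurableTypeR R) : R := K * (L * `|b0 r| * expR (lam * r)).
have hA0 r : 0 <= hA r by rewrite mulr_ge0// normr_ge0.
have hB0 r : 0 <= hB r by rewrite mulr_ge0 ?normr_ge0// mulr_ge0// addr_ge0// mulr_ge0.
have hb0 r : 0 <= hb r by rewrite !mulr_ge0// ?normr_ge0// expR_ge0.
have mhA : measurable_fun setT (fun r => (hA r)%:E).
  by apply/measurable_EFinP; exact: measurable_funM.
have mhB : measurable_fun setT (fun r => (hB r)%:E).
  by apply/measurable_EFinP; exact: measurable_funM.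
have mhb' : measurable_fun setT (fun r => (L * `|b0 r| * expR (lam * r))%:E).
  by apply/measurable_EFinP; apply: measurable_funM => //; exact: measurable_funM.
have mhb : measurable_fun setT (fun r => (hb r)%:E).
  by apply/measurable_EFinP; apply: measurable_funM => //; exact/measurable_EFinP.
apply: (@le_trans _ _ (\int[tm t]_r (((hA r)%:E + (hB r)%:E) + (hb r)%:E))%E).
  apply: ae_ge0_le_integral => //.
  - by move=> r _; rewrite lee_fin normr_ge0.
  - by apply/measurable_EFinP; exact: measurable_dist.
  - by move=> r _; rewrite !adde_ge0// lee_fin.
  - by apply: emeasurable_funD => //; exact: emeasurable_funD.
  - have h0 := ae_time_measure_le tT g0P; have h := ae_time_measure_le tT gP.
    apply: filterS3 h0 h (ae_time_measure t) => r g0r gr /andP[r0 rt] _.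
    rewrite -!EFinD lee_fin (L2_dist_eq _ gr).
    rewrite distrC (L2_dist_eq _ g0r) distrC (le_trans (rhs_dist _ _ _ _ _ _ _ _ _))//.
    have r0T : 0 <= r <= T by rewrite (ltW r0) (ltW (lt_le_trans rt tT)).
    have fr := fK _ r0T; have f0r := f0M r0T.
    have er : expR (lam * r) <= e by rewrite ler_expR ler_pM2l// ltW.
    have hf : `|f r| <= M + K * e.
      rewrite -[f r](subrK (f0 r)) addrC (le_trans (ler_normD _ _))// lerD//.
      by rewrite (le_trans fr)// ler_wpM2l.
    rewrite !mulrDr addrA; apply: lerD; first apply: lerD => //.
      by rewrite /hB -mulrA ler_wpM2l// mulrC ler_wpM2r ?normr_ge0.
    rewrite /hb (_ : K * _ = L * (`|b0 r| * (K * expR (lam * r)))); last by ring.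
    by rewrite ler_wpM2l// ler_wpM2l ?normr_ge0.
rewrite ge0_integralD//; last 3 first.
- by move=> r _; rewrite adde_ge0// lee_fin.
- exact: emeasurable_funD.
- by move=> r _; rewrite lee_fin.
rewrite ge0_integralD//; last 2 first.
- by move=> r _; rewrite lee_fin.
- by move=> r _; rewrite lee_fin.
have iA : (\int[tm t]_r (hA r)%:E <= (L * dl)%:E)%E.
  apply: (@le_trans _ _ (\int[tm T]_r (hA r)%:E)%E).
    by apply: le_integral_time_measure => // r; rewrite lee_fin.
  under eq_integral do rewrite EFinM.
  rewrite ge0_integralZl_EFin//; last 2 first.
  - by move=> r _; rewrite lee_fin normr_ge0.
  - exact/measurable_EFinP.
  by rewrite -bochner_distE -EFinM lee_fin ler_wpM2l.
have iB : (\int[tm t]_r (hB r)%:E <= (L * (M + K * e) * dl)%:E)%E.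
  apply: (@le_trans _ _ (\int[tm T]_r (hB r)%:E)%E).
    by apply: le_integral_time_measure => // r; rewrite lee_fin.
  have c0 : 0 <= L * (M + K * e) by rewrite mulr_ge0// addr_ge0// mulr_ge0.
  under eq_integral do rewrite EFinM.
  rewrite ge0_integralZl_EFin//; last 2 first.
  - by move=> r _; rewrite lee_fin normr_ge0.
  - exact/measurable_EFinP.
  by rewrite -bochner_distE -EFinM lee_fin ler_wpM2l.
have ib : (\int[tm t]_r (hb r)%:E <= (K * (4^-1 * e))%:E)%E.
  under eq_integral do rewrite EFinM.
  rewrite ge0_integralZl_EFin//; last first.
    by move=> r _; rewrite lee_fin !mulr_ge0 ?normr_ge0 ?expR_ge0.
  by rewrite EFinM lee_wpmul2l ?lee_fin// lamP.
apply: le_trans (leeD (leeD iA iB) ib) _.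
rewrite -!EFinD lee_fin.
(* The term [q * (K * e)] from [hB] and the term from [lamP] each cost a quarter of [K * e],
   together the announced [K / 2]; the factors [e >= 1] bring the rest under the common weight. *)
set q := L * dl; have q4 : q <= 4^-1 by exact: dl4.
have q0 : 0 <= q by rewrite mulr_ge0.
have h1 : q <= q * e by rewrite ler_peMr.
have h2 : q * M <= q * M * e by rewrite ler_peMr// mulr_ge0.
have h3 : q * (K * e) <= 4^-1 * (K * e) by rewrite ler_wpM2r// mulr_ge0.
rewrite (_ : L * (M + K * e) * dl = q * M + q * (K * e)); last by rewrite /q; ring.
by lra.
Qed.

Lemma stability_bound t : 0 <= t <= T ->
  `|f t - f0 t| <= 2 * (L * dl * (1 + M)) * expR (lam * t).
Proof.
have [[M1 fM1] _] := sol.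
set A := L * dl * (1 + M).
have A0 : 0 <= A by rewrite mulr_ge0 ?addr_ge0// mulr_ge0.
have M10 : 0 <= M1.
  by apply: le_trans (normr_ge0 (f 0)) _; apply: fM1; rewrite lexx ltW.
(* [2 * A] is the fixed point of K -> A + K / 2, and the excess halves at each round. [M1], which
   depends on [f], enters the excess only and disappears in the limit. *)
have h n t' : 0 <= t' <= T ->
    `|f t' - f0 t'| <= (2 * A + (M1 + M) / 2 ^+ n) * expR (lam * t').
  elim: n t' => [|n ih] t' t'T.
    rewrite expr0 divr1 (le_trans (ler_normB _ _))//.
    rewrite (le_trans (lerD (fM1 _ t'T) (f0M t'T)))//.
    have e1 : 1 <= expR (lam * t').
      by rewrite -[1]expR0 ler_expR mulr_ge0//; [exact: ltW|case/andP: t'T].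
    apply: (@le_trans _ _ (2 * A + (M1 + M))); first by rewrite lerDr mulr_ge0.
    by rewrite ler_peMr// !addr_ge0// mulr_ge0.
  have K0 : 0 <= 2 * A + (M1 + M) / 2 ^+ n.
    by rewrite addr_ge0 ?mulr_ge0 ?addr_ge0 ?invr_ge0.
  rewrite (le_trans (stability_step K0 ih t'T))// ler_wpM2r ?expR_ge0//.
  rewrite le_eqVlt exprS invfM; apply/orP; left; apply/eqP; rewrite -/A; field.
  by rewrite expf_neq0.
move=> tT; apply: (@le_half_pow _ _ _ ((M1 + M) * expR (lam * t))) => n.
by rewrite (le_trans (h n t tT))// mulrDl lerD2l mulrAC.
Qed.

End two_solutions.

(** [lam] and [M] come from the reference data alone, so one [dl] serves all solutions with nearby
    coefficients. For equal coefficients this contains uniqueness at time [T]. *)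
Lemma stability a0 b0 fI f0 : bounded_solution a0 b0 fI f0 ->
  forall e : R, 0 < e -> exists2 dl : R, 0 < dl &
    forall a b f, bounded_solution a b fI f ->
      bochner_dist a a0 <= dl -> bochner_dist b b0 <= dl -> `|f T - f0 T| <= e.
Proof.
move=> sol0 e e0; have [[M f0M] _] := sol0.
have TT : 0 <= T <= T by rewrite lexx ltW.
have M0 : 0 <= M by exact: le_trans (normr_ge0 (f0 T)) (f0M _ TT).
have beta0 r : 0 <= L * `|b0 r| by rewrite mulr_ge0// normr_ge0.
have mb := strong_limit_norm_measurable (bochnerL1_strong_limit b0).
have mbeta : measurable_fun setT (fun r : measurableTypeR R => L * `|b0 r|).
  exact: measurable_funM.
have beta_fin : (\int[tm T]_r (L * `|b0 r|)%:E < +oo)%E.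
  under eq_integral do rewrite EFinM.
  rewrite ge0_integralZl_EFin//; last 2 first.
  - by move=> r _; rewrite lee_fin normr_ge0.
  - exact/measurable_EFinP.
  by rewrite lte_mul_pinfty// ?lee_fin//; exact: bochner_integrable.
have c0 : 0 < 4^-1 :> R by [].
have [lam lam0 lamP] := bielecki c0 beta0 mbeta beta_fin.
pose E := expR (lam * T); have E0 : 0 < E by exact: expR_gt0.
pose C := 2 * (L * (1 + M)) * E.
have C0 : 0 <= C by rewrite !mulr_ge0 ?addr_ge0// ltW.
have C1 : 0 < C + 1 by rewrite ltr_wpDl.
have L1 : 0 < L + 1 by rewrite ltr_wpDl.
(* The first entry secures [L * dl <= 4^-1], the second makes the final bound [C * dl] at most [e];
   adding 1 avoids dividing by zero. *)
pose dl := Num.min (4^-1 / (L + 1)) (e / (C + 1)).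
have dl0 : 0 < dl by rewrite lt_min !divr_gt0.
exists dl => // a b f sol da db.
have dl4 : L * dl <= 4^-1.
  apply: (@le_trans _ _ ((L + 1) * dl)); first by rewrite ler_wpM2r ?lerDl ?ltW.
  by rewrite mulrC -ler_pdivlMr// ge_min lexx.
apply: le_trans (stability_bound sol0 sol lam0 f0M lamP da db dl4 TT) _.
rewrite (_ : 2 * _ * _ = C * dl); last by rewrite /C /E; ring.
apply: (@le_trans _ _ ((C + 1) * dl)); first by rewrite ler_wpM2r ?lerDl ?ltW.
by rewrite mulrC -ler_pdivlMr// ge_min lexx orbT.
Qed.

End stability.

(** * Uniform boundedness *)

Section uniform_boundedness.
Context d (X : measurableType d) (R : realType) (nu : {measure set X -> \bar R}).
Hypothesis nufin : (nu setT < +oo)%E.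
Variables (I : Type) (S : set I) (q : I -> L2 nu -> R) (C : I -> R).
Hypotheses (C0 : forall i, 0 <= C i) (qC : forall i x, q i x <= C i * `|x|).
Hypothesis qD : forall i x y, q i (x + y) <= q i x + q i y.
Hypothesis qZ : forall i (c : R) x, q i (c *: x) = `|c| * q i x.
Hypothesis q_pointwise : forall x, exists M, forall i, S i -> q i x <= M.

Let qN i x : q i (- x) = q i x.
Proof. by rewrite -scaleN1r qZ normrN normr1 mul1r. Qed.

(** Since [2 * eta = (x + eta) + (eta - x)], a seminorm that is large at [eta] is large at [x + eta]
    or at [x - eta], whatever its value at the centre. Its continuity then keeps it large on a small
    ball around that point. *)
Let large_ball (n : nat) (x : L2 nu) (r : R) : 0 < r ->
  ~ (exists M, forall i, S i -> forall x, q i x <= M * `|x|) ->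
  exists y r', [/\ 0 < r', r' <= r / 2, `|y - x| <= r / 2 &
    exists2 i, S i & forall z, `|z - y| <= r' -> n.+1%:R <= q i z].
Proof.
move=> r0 unb; pose m : R := n.+1%:R; have m0 : 0 < m by rewrite ltr0n.
(* After rescaling [xi] to norm [r / 2] the factor [4 * m / r] becomes the value [2 * m]; the radius
   [m / c] chosen below gives up at most [m] of it. *)
have [i Si [xi qxi]] : exists2 i, S i & exists x, 4 * m / r * `|x| < q i x.
  apply: contrapT => h; apply: unb; exists (4 * m / r) => i Si z.
  by rewrite leNgt; apply/negP => lt; apply: h; exists i => //; exists z.
have xi0 : 0 < `|xi|.
  rewrite lt_neqAle normr_ge0 andbT eq_sym; apply/negP => /eqP x0.
  by have := lt_le_trans qxi (qC i xi); rewrite x0 !mulr0 ltxx.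
pose eta : L2 nu := (r / 2 / `|xi|) *: xi.
have etaE : `|eta| = r / 2.
  by rewrite L2_normZ ger0_norm ?divr_ge0 ?(ltW r0) ?normr_ge0// divfK// gt_eqF.
have qeta : 2 * m < q i eta.
  rewrite qZ ger0_norm ?divr_ge0 ?(ltW r0) ?normr_ge0//.
  have c0 : 0 < r / 2 / `|xi| by rewrite !divr_gt0.
  rewrite -(ltr_pM2l c0) in qxi; apply: le_lt_trans qxi.
  rewrite le_eqVlt; apply/orP; left; apply/eqP; field.
  by rewrite !gt_eqF.
have [y yx qy] : exists2 y, `|y - x| <= r / 2 & 2 * m <= q i y.
  have [h|h] := leP (2 * m) (q i (x + eta)).
    by exists (x + eta) => //; rewrite addrC addKr etaE.
  exists (x - eta); first by rewrite addrC addKr normrN etaE.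
  rewrite leNgt; apply/negP => h'.
  have := qD i (x + eta) (eta - x).
  rewrite addrC addrA subrK -mulr2n -scaler_nat qZ ger0_norm// -opprB qN.
  by move: h h' qeta; lra.
pose c := C i + 1; have c0 : 0 < c by rewrite ltr_wpDl.
exists y, (Num.min (r / 2) (m / c)); split => //.
- by rewrite lt_min !divr_gt0.
- by rewrite ge_min lexx.
exists i => // z zy.
have h := qD i z (y - z).
rewrite addrC subrK in h.
have h2 : q i (y - z) <= m.
  rewrite (le_trans (qC _ _))// distrC (@le_trans _ _ (c * `|z - y|))//.
    by rewrite ler_wpM2r ?normr_ge0// lerDl.
  rewrite mulrC -ler_pdivlMr// (le_trans zy)// ge_min lexx orbT//.
by rewrite -/m; lra.
Qed.

(* Gliding nested balls: on the (n+1)-st ball some [q i] is at least n+1, which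
   contradicts pointwise boundedness at the common point of the balls. *)
Lemma uniform_boundedness :
  exists M, forall i, S i -> forall x, q i x <= M * `|x|.
Proof.
apply: contrapT => unb.
have step n (p : L2 nu * R) : exists p' : L2 nu * R, 0 < p.2 ->
   [/\ 0 < p'.2, p'.2 <= p.2 / 2, `|p'.1 - p.1| <= p.2 / 2 &
    exists2 i, S i & forall z, `|z - p'.1| <= p'.2 -> n.+1%:R <= q i z].
  have [p0|p0] := ltP 0 p.2; last by exists p.
  by have [y [r' h]] := large_ball n p.1 p0 unb; exists (y, r').
have /choice[F FP] : forall np : nat * (L2 nu * R), exists p' : L2 nu * R,
   0 < np.2.2 ->
   [/\ 0 < p'.2, p'.2 <= np.2.2 / 2, `|p'.1 - np.2.1| <= np.2.2 / 2 &
    exists2 i, S i & forall z, `|z - p'.1| <= p'.2 -> np.1.+1%:R <= q i z].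
  by move=> [n p]; exact: step.
pose u := fix u n : L2 nu * R := if n is k.+1 then F (k, u k) else (0, 1).
have u0 n : 0 < (u n).2.
  by elim: n => [|n ih] /=; [exact: ltr01|have [] := FP (n, u n) ih].
have uS n := FP (n, u n) (u0 n).
have r_le n : (u n).2 <= 1 / 2 ^+ n.
  elim: n => [|n ih]; first by rewrite expr0 divr1.
  have [_ h _ _] := uS n; rewrite (le_trans h)//.
  rewrite (_ : 1 / 2 ^+ n.+1 = 1 / 2 ^+ n / 2); first by rewrite ler_wpM2r.
  by rewrite exprS invfM; ring.
have stepu n : `|(u n.+1).1 - (u n).1| <= 1 / 2 ^+ n.
  have [_ _ h _] := uS n; rewrite (le_trans h)//; apply: le_trans (r_le n).
  by have := u0 n; lra.
have [x xP] := L2_complete nufin stepu.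
have nested n k z : `|z - (u (n + k)%N).1| <= (u (n + k)%N).2 ->
    `|z - (u n).1| <= (u n).2.
  elim: k => [|k ih]; first by rewrite addn0.
  rewrite addnS => h; apply: ih; have [_ h1 h2 _] := uS (n + k)%N.
  rewrite (le_trans (ler_distD (u (n + k).+1).1 _ _))//.
  by rewrite [leRHS]splitr lerD// (le_trans h).
have xu n : `|x - (u n).1| <= (u n).2.
  apply: (@le_half_pow _ _ _ 2) => k.
  have h : `|(u (n + k)%N).1 - (u n).1| <= (u n).2.
    by apply: (nested n k); rewrite subrr normr0 ltW.
  rewrite (le_trans (ler_distD (u (n + k)%N).1 _ _))// addrC lerD//.
  rewrite (le_trans (xP _))// mulr1 ler_wpM2l// lef_pV2 ?posrE ?exprn_gt0//.
  by rewrite ler_eXn2l ?ltr1n// leq_addl.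
have [M MP] := q_pointwise x.
(* On the ball of index [truncn M + 1] some [q i] is at least [truncn M + 1], which exceeds [M]. *)
have [_ _ _ [i Si h]] := uS (Num.truncn M).
have := le_trans (h x (xu (Num.truncn M).+1)) (MP i Si).
by rewrite leNgt truncnS_gt.
Qed.

End uniform_boundedness.

(** * Finiteness of Lebesgue measure on bounded open sets *)

Section bounded_finite_measure.
Context {R : realType}.

Let box n (M : R) : set 'rV[R]_n := \bigcap_(i : 'I_n) [set x | `|x ord0 i| <= M].

Arguments box : clear implicits.

Let measurable_box n M : measurable (box n M).
Proof.
apply: fin_bigcap_measurable => [|i _].
  by rewrite (_ : setT = [set` predT]) ?predeqE; [exact: finite_finpred|split].
rewrite (_ : (fun x => _) =
  (fun x : 'rV[R]_n => x ord0 i : measurableTypeR R) @^-1` `[- M, M]%classic).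
  by rewrite -[X in measurable X]setTI; apply: measurable_coor => //; exact: measurable_itv.
by apply/seteqP; split => x /=; rewrite in_itv/= ler_norml.
Qed.

Let lebesgue_box n M : (lebesgue_rV n (box n M) < +oo)%E.
Proof.
elim: n => [|n ih].
  by apply: (@le_lt_trans _ _ (1%:E)); rewrite ?ltry// /= diracE lee_fin; case: (_ \in _).
rewrite /= /lebesgue_rV_step /pushforward.
apply: (@le_lt_trans _ _ ((lebesgue_measure \x lebesgue_rV n)%E
    ((`[- M, M]%classic : set (measurableTypeR R)) `*` box n M))).
  apply: le_measure; rewrite ?inE.
  - rewrite -[X in measurable X]setTI; apply: measurable_rV_cons => //.
    exact: measurable_box.
  - by apply: measurableX; [exact: measurable_itv|exact: measurable_box].
  - move=> [y z] /= h; split => /=.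
      have := h ord0 Logic.I; rewrite /= /rV_cons mxE unlift_none /=.
      by rewrite in_itv/= ler_norml.
    move=> j _ /=; have := h (lift ord0 j) Logic.I.
    by rewrite /= /rV_cons mxE liftK.
rewrite product_measure1E; [|exact: measurable_itv|exact: measurable_box].
have mfin : lebesgue_measure (`[- M, M]%classic : set (measurableTypeR R)) \is a fin_num.
  by rewrite lebesgue_measure_itv/=; case: ifP.
rewrite lte_mul_pinfty ?measure_ge0//.
Qed.

Lemma bounded_lebesgue_on_fin n (Y : set 'rV[R]_n) (oY : open Y) :
  bounded_set Y -> (lebesgue_on oY setT < +oo)%E.
Proof.
move=> bY; have [M [_ MP]] := bY.
have YM : Y `<=` box n (M + 1).
  move=> y Yy i _ /=; have := MP _ (ltr_pwDr ltr01 (lexx M)) y Yy.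
  apply: le_trans; rewrite [leRHS]/Num.norm/= mx_normrE.
  exact: (le_bigmax _ (fun ij : 'I_1 * 'I_n => `|y ij.1 ij.2|) (ord0, i)).
apply: le_lt_trans (lebesgue_box n (M + 1)).
rewrite /lebesgue_on /mrestr setTI le_measure ?inE//.
  exact: open_measurable_rV.
exact: measurable_box.
Qed.

End bounded_finite_measure.

(** * Continuity of the loss *)

Section gauge_neighbourhoods.
Context {R : realType} {M : choiceType} {I : Type} (dist : I -> M -> M -> R).

Lemma gauge_ball_nbhs (i : I) (x : gauge_topology dist) (e : R) :
  (forall y, dist i y y = 0) ->
  (forall y z t, dist i y t <= dist i y z + dist i z t) ->
  0 < e -> nbhs x [set y | dist i x y < e].
Proof.
move=> d0 dD e0; apply: open_nbhs_nbhs; split; last by rewrite /= d0.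
suff : gauge_open dist [set y | dist i x y < e] by [].
move=> y /= xy; exists (e - dist i x y), [set i]; split.
- by rewrite subr_gt0.
- exact: finite_set1.
- move=> z /= /(_ i erefl) yz.
  by rewrite (le_lt_trans (dD _ y _))//; lra.
Qed.

Lemma gauge_continuous_at (i : I) (h : M -> R) (x : gauge_topology dist) :
  (forall y, dist i y y = 0) ->
  (forall y z t, dist i y t <= dist i y z + dist i z t) ->
  (forall e : R, 0 < e -> exists2 dl : R, 0 < dl &
     forall y, dist i x y < dl -> `|h x - h y| < e) ->
  {for x, continuous (h : gauge_topology dist -> R)}.
Proof.
move=> d0 dD hx.
apply: (@cvgrPdist_lt _ R _ _ (nbhs_filter x) h (h x)).2 => e /hx[dl dl0 hdl].
have ball_sub : [set y | dist i x y < dl] `<=` [set y | `|h x - h y| < e].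
  by move=> y /hdl.
exact: (@filterS _ _ (nbhs_filter x) _ _ ball_sub (gauge_ball_nbhs x d0 dD dl0)).
Qed.

Lemma nbhs_gauge_ball (x : gauge_topology dist) (A : set (gauge_topology dist)) :
  nbhs x A -> exists e F, [/\ 0 < e, finite_set F &
    [set y | forall i, F i -> dist i x y < e] `<=` A].
Proof.
rewrite nbhsE => -[B [oB Bx] BA].
have gB : gauge_open dist B := oB.
have [e [F [e0 fF FB]]] := gB x Bx; exists e, F; split => //.
exact: subset_trans BA.
Qed.

End gauge_neighbourhoods.

Section L2_gauge.
Context d (X : measurableType d) (R : realType) (nu : {measure set X -> \bar R}).

Lemma unif_cont_continuous (f : R -> L2 nu) :
  unif_cont f -> continuous (f : R -> L2_strong nu).
Proof.
move=> cf t A /nbhs_gauge_ball[e [F [e0 _ FA]]].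
have [dl dl0 h] := cf e e0.
apply/nbhs_ballP; exists dl => // t' tt'; apply: FA => i _.
exact: h.
Qed.

Lemma L2_strong_ball_nbhs (x : L2_strong nu) (e : R) : 0 < e ->
  nbhs x [set y : L2_strong nu | `|(x : L2 nu) - (y : L2 nu)| < e].
Proof.
move=> e0; apply: (gauge_ball_nbhs (i := tt)) => //.
- by move=> y; rewrite subrr normr0.
- by move=> y z t; exact: ler_distD.
Qed.

Lemma within_continuous_bounded (T : R) (f : R -> L2 nu) :
  {within `[0, T], continuous (f : R -> L2_strong nu)} ->
  exists M, forall t, 0 <= t <= T -> `|f t| <= M.
Proof.
move=> cf.
have cn : continuous (fun x : L2_strong nu => `|(x : L2 nu)| : R).
  move=> x; apply: (gauge_continuous_at (i := tt)).
  - by move=> y; rewrite subrr normr0.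
  - by move=> y z t; exact: ler_distD.
  - move=> e e0; exists e => // y; apply: le_lt_trans.
    exact: ler_dist_dist.
have cnf : {within `[0, T], continuous (fun t => `|f t| : R)}.
  move=> t; exact: (continuous_comp (cf t) (cn _)).
have := continuous_compact cnf (@segment_compact _ 0 T).
move=> /compact_bounded[M [_ MP]]; exists (M + 1) => t tT.
have := MP _ (ltr_pwDr ltr01 (lexx M)) `|f t|.
move=> h; apply: (le_trans (ler_norm _)); apply: h; by exists t.
Qed.

End L2_gauge.

Lemma lipschitz_bound (R : realType) (s : R -> R) : lipschitz s ->
  exists2 L : R, 0 <= L & forall x y, `|s x - s y| <= L * `|x - y|.
Proof.
move=> [M [_ MP]]; exists (Num.max 0 (M + 1)); first by rewrite le_max lexx.
move=> x y; have M1 : M < M + 1 by rewrite ltrDl.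
have := MP _ M1 (x, y) (conj Logic.I Logic.I); move=> /= /le_trans; apply.
by rewrite ler_wpM2r// le_max lexx orbT.
Qed.

Lemma cvg_ord_sum (R : realType) (T : Type) (F : set_system T) (FF : Filter F)
    n (f : 'I_n -> T -> R) (l : 'I_n -> R) :
  (forall i, f i x @[x --> F] --> l i) ->
  \sum_(i < n) f i x @[x --> F] --> \sum_(i < n) l i.
Proof.
elim: n f l => [|n ih] f l fl.
  by under eq_fun do rewrite big_ord0; rewrite big_ord0; exact: cvg_cst.
under eq_fun do rewrite big_ord_recr; rewrite big_ord_recr/=.
by apply: cvgD; [exact: ih|exact: fl].
Qed.

Section network.
Context {R : realType} {d l : nat} {Y : set 'rV[R]_d} {U : set 'rV[R]_l}.
Variables (oY : open Y) (oU : open U) (T : R) (T0 : 0 < T).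
Hypotheses (Yfin : (lebesgue_on oY setT < +oo)%E)
  (Ufin : (lebesgue_on oU setT < +oo)%E).
Local Notation muY := (lebesgue_on oY).
Local Notation muU := (lebesgue_on oU).
Local Notation tm := (@time_measure R).
Local Notation params := (param_space oY oU T).

Section solution.
Variables (s : R -> R) (L : R) (L0 : 0 <= L).
Hypothesis sL : forall x y, `|s x - s y| <= L * `|x - y|.
Variables (a : bochnerL1 (tm T) muY) (b : bochnerL1 (tm T) (muY \x muY)%E) (fI : L2 muY).

Lemma is_solution_exists : exists f, is_solution s a b fI f.
Proof.
have [f [cf fP]] := solution_exists Yfin L0 sL a b fI.
exists f; split; first exact/continuous_subspaceT/unif_cont_continuous.
exists (fun r => rhs Yfin L0 sL (a r) (b r) (f r)).
  by apply: aeW => t; apply: aeW.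
by move=> t /andP[_ tT]; have := fP t; rewrite min_l.
Qed.

Lemma is_solution_bounded f : is_solution s a b fI f ->
  bounded_solution Yfin L0 sL a b fI f.
Proof.
move=> [cf [g gP ig]]; split; first exact: within_continuous_bounded.
exists g => //.
apply: (@filterS _ _ (ae_filter_ringOfSetsType (tm T)) _ _ _ gP) => t gt.
apply: L2_norm_ae0.
apply: filterS gt => y gy; rewrite L2E_add L2E_opp gy.
by rewrite subrr.
Qed.

Lemma solution_bounded : bounded_solution Yfin L0 sL a b fI (solution s a b fI).
Proof.
apply: is_solution_bounded.
exact: (@xgetPex _ (fun=> 0) [set f | is_solution s a b fI f] is_solution_exists).
Qed.

End solution.

Definition par_a (p : params) : bochnerL1 (tm T) muY := p.1.1.1.
Definition par_b (p : params) : bochnerL1 (tm T) (muY \x muY)%E := p.1.1.2.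
Definition par_w (p : params) : L2 (muU \x muY)%E := p.1.2.
Definition par_mu (p : params) : L2 muU := p.2.

Lemma near_bochner_dist d' (X' : measurableType d') (nu' : {measure set X' -> \bar R})
    (x : L1L2_strong (tm T) nu') (e : R) : 0 < e ->
  nbhs x [set y : L1L2_strong (tm T) nu' |
    bochner_dist (x : bochnerL1 (tm T) nu') (y : bochnerL1 (tm T) nu') < e].
Proof.
move=> e0; apply: (gauge_ball_nbhs (i := tt)) => //.
- move=> y; apply: EFin_inj; rewrite bochner_distE.
  by under eq_integral do rewrite subrr normr0; rewrite integral0.
- move=> y z t; rewrite -lee_fin EFinD.
  rewrite (bochner_distE y t) (bochner_distE y z) (bochner_distE z t).
  by apply: integral_dist_triangle; exact: bochnerL1_strong_limit.
Qed.

(** The generating seminorm at [phi] is by definition the norm of [kernel_op (w - w') phi];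
    [kernel_op_distl] turns it into a distance, for which the triangle inequality is at hand. *)
Lemma near_kernel_dist (phi : L2 muY) (w : L2_strong_weak muU muY) (e : R) : 0 < e ->
  nbhs w [set w' : L2_strong_weak muU muY |
    `|kernel_op (w : L2 (muU \x muY)%E) phi -
      kernel_op (w' : L2 (muU \x muY)%E) phi| < e].
Proof.
move=> e0.
pose dist (phi : L2 muY) (w w' : L2 (muU \x muY)%E) : R :=
  fine ('N[muU]_2%:E[EFin \o (fun u =>
      \int[muY]_y ((w (u, y) - w' (u, y)) * phi y))%R])%E.
have distE psi v v' : dist psi v v' = `|kernel_op v psi - kernel_op v' psi|.
  by rewrite kernel_op_distl.
have : nbhs (w : gauge_topology dist) [set w' | dist phi w w' < e].
  apply: (gauge_ball_nbhs (i := phi)) => //.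
  - by move=> y; rewrite distE subrr normr0.
  - by move=> y z t; rewrite !distE ler_distD.
have -> // : [set w' | dist phi w w' < e] = [set w' : L2 (muU \x muY)%E |
    `|kernel_op (w : L2 (muU \x muY)%E) phi - kernel_op w' phi| < e].
by apply/funext => w'; rewrite /= distE.
Qed.

Lemma near_fst (A B : topologicalType) (p : A * B) (S : set A) :
  nbhs p.1 S -> nbhs p [set q | S q.1].
Proof. by move=> pS; exact: (@cvg_fst _ _ (nbhs p.1) (nbhs p.2) _ _ pS). Qed.

Lemma near_snd (A B : topologicalType) (p : A * B) (S : set B) :
  nbhs p.2 S -> nbhs p [set q | S q.2].
Proof. by move=> pS; exact: (@cvg_snd _ _ (nbhs p.1) (nbhs p.2) _ _ pS). Qed.

Lemma near_par_a (p0 : params) (e : R) : 0 < e ->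
  nbhs p0 [set p | bochner_dist (par_a p0) (par_a p) < e].
Proof.
move=> e0.
exact: (near_fst (near_fst (near_fst (near_bochner_dist p0.1.1.1 e0)))).
Qed.

Lemma near_par_b (p0 : params) (e : R) : 0 < e ->
  nbhs p0 [set p | bochner_dist (par_b p0) (par_b p) < e].
Proof.
move=> e0.
exact: (near_fst (near_fst (near_snd (near_bochner_dist p0.1.1.2 e0)))).
Qed.

Lemma near_par_w (phi : L2 muY) (p0 : params) (e : R) : 0 < e ->
  nbhs p0 [set p | `|kernel_op (par_w p0) phi - kernel_op (par_w p) phi| < e].
Proof.
by move=> e0; exact: (near_fst (near_snd (near_kernel_dist phi p0.1.2 e0))).
Qed.

Lemma near_par_mu (p0 : params) (e : R) : 0 < e ->
  nbhs p0 [set p | `|par_mu p0 - par_mu p| < e].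
Proof. by move=> e0; exact: (near_snd (L2_strong_ball_nbhs p0.2 e0)). Qed.

Lemma bochner_distC d' (X' : measurableType d') (nu' : {measure set X' -> \bar R})
    (a a' : bochnerL1 (tm T) nu') : bochner_dist a a' = bochner_dist a' a.
Proof. by apply: eq_Rintegral => t _; rewrite distrC. Qed.

(* Neighbourhoods in [L2_strong_weak] do not bound `|w|; on a compact set the
   operator norms are bounded by uniform boundedness, and this is what makes
   [w, f |-> kernel_op w f] jointly continuous. *)
Lemma compact_kernel_op_bound (S0 : set params) : compact S0 ->
  exists M, forall p, S0 p -> forall phi,
    `|kernel_op (par_w p) phi| <= M * `|phi|.
Proof.
move=> cS.
apply: (@uniform_boundedness _ _ _ muY Yfin params S0
  (fun p phi => `|kernel_op (par_w p) phi|) (fun p => `|par_w p|)).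
- by move=> p; exact: normr_ge0.
- by move=> p phi; exact: kernel_op_norm.
- move=> p phi psi.
  have := L2_dist_eq 0 (kernel_opDr (par_w p) phi psi); rewrite !subr0 => ->.
  exact: ler_normD.
- move=> p c phi.
  have := L2_dist_eq 0 (kernel_opZr (par_w p) c phi); rewrite !subr0 => ->.
  exact: L2_normZ.
- move=> phi; have [->|S0n] := eqVneq S0 set0; first by exists 0.
  (* At a fixed [phi] this norm is continuous in the strong-weak topology, so it attains a maximum
     on the compact set: this is the pointwise bound. *)
  have cq : {within S0, continuous (fun p => `|kernel_op (par_w p) phi| : R)}.
    apply: continuous_subspaceT => p0.
    apply: (@cvgrPdist_lt _ R _ _ (nbhs_filter p0) _ _).2 => e e0.
    apply: (@filterS _ _ (nbhs_filter p0) _ _ _ (near_par_w phi p0 e0)) => p.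
    by apply: le_lt_trans; exact: ler_dist_dist.
  move/set0P : S0n => S0n.
  have [c _ cP] := compact_EVT_max S0n cS cq.
  exists `|kernel_op (par_w c) phi| => p Sp.
  by apply: cP; rewrite inE.
Qed.

Section loss.
Variables (s h : R -> R) (L Lh : R) (L0 : 0 <= L) (Lh0 : 0 <= Lh).
Hypothesis sL : forall x y, `|s x - s y| <= L * `|x - y|.
Hypothesis hL : forall x y, `|h x - h y| <= Lh * `|x - y|.
Variables (S0 : set params) (cS0 : compact S0).

Definition preactivation (fI : L2 muY) (p : params) : L2 muU :=
  kernel_op (par_w p) (solution s (par_a p) (par_b p) fI T) + par_mu p.

(** The topology on w is tested at one fixed vector, the reference solution at time [T]. The
    displacement of the solution is then fed to the moving operator, which is controlled by the
    uniform bound; this is where [S0 p] is needed. *)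
Lemma near_preactivation fI p0 (e : R) : 0 < e ->
  nbhs p0 [set p | S0 p -> `|preactivation fI p0 - preactivation fI p| < e].
Proof.
move=> e0; have [M MP] := compact_kernel_op_bound cS0.
have e3 : 0 < e / 3 by rewrite divr_gt0.
(* Nothing tells the sign of [M]; a positive majorant is needed to divide by. *)
pose M1 := `|M| + 1; have M10 : 0 < M1 by rewrite ltr_wpDl.
have eM : 0 < e / 3 / M1 / 2 by rewrite !divr_gt0.
pose F p := solution s (par_a p) (par_b p) fI.
have solF p : bounded_solution Yfin L0 sL (par_a p) (par_b p) fI (F p).
  exact: solution_bounded.
have [dl dl0 dlP] := stability T0 (solF p0) eM.
apply: (@filterS _ _ (nbhs_filter p0) _ _ _
  (filterI (filterI (near_par_a p0 dl0) (near_par_b p0 dl0))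
           (filterI (near_par_w (F p0 T) p0 e3) (near_par_mu p0 e3)))).
move=> p [[pa pb] [pw pm]] Sp.
have {}pw : `|kernel_op (par_w p0) (F p0 T) - kernel_op (par_w p) (F p0 T)| < e / 3.
  exact: pw.
have {}pm : `|par_mu p0 - par_mu p| < e / 3 by exact: pm.
have pF : `|F p T - F p0 T| <= e / 3 / M1 / 2.
  by apply: (dlP _ _ _ (solF p)); rewrite bochner_distC; exact: ltW.
have h1 : `|kernel_op (par_w p) (F p0 T) - kernel_op (par_w p) (F p T)| < e / 3.
  rewrite kernel_op_distr (le_lt_trans (MP p Sp _))//.
  rewrite distrC (@le_lt_trans _ _ (M1 * (e / 3 / M1 / 2)))//.
    apply: (@le_trans _ _ (M1 * `|F p T - F p0 T|)); last by rewrite ler_wpM2l// ltW.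
    by rewrite ler_wpM2r ?normr_ge0// (le_trans (ler_norm _))// lerDl.
  rewrite (_ : M1 * _ = e / 3 / 2); last by field; rewrite gt_eqF.
  by rewrite gtr_pMr// invf_lt1// ltr1n.
rewrite /preactivation -/(F p) -/(F p0) opprD addrACA.
rewrite (le_lt_trans (ler_normD _ _))//.
rewrite [ltRHS](_ : e = (e / 3 + e / 3) + e / 3); last by field.
apply: (ltrD _ pm).
apply: le_lt_trans (ler_distD (kernel_op (par_w p) (F p0 T)) _ _) _.
exact: (ltrD pw h1).
Qed.

Lemma lossE N (fI : 'I_N -> L2 muY) (P : 'I_N -> L2 muU) p :
  loss s h fI P p = (2 * N%:R)^-1 * \sum_(j < N)
    `|superposition Ufin Lh0 hL (preactivation (fI j) p) - P j| ^+ 2.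
Proof.
rewrite /loss; congr (_ * _); apply: eq_bigr => j _.
apply: EFin_inj; rewrite L2_normsqE /Rintegral.
rewrite (_ : (fun u => _) = fun u => (((superposition Ufin Lh0 hL
   (preactivation (fI j) p) - P j) u) ^+ 2)%:E).
  by rewrite fineK// -L2_normsqE.
by apply/funext => u; rewrite real_normK ?num_real.
Qed.

Lemma loss_continuous N (fI : 'I_N -> L2 muY) (P : 'I_N -> L2 muU) :
  {within S0, continuous (loss s h fI P)}.
Proof.
apply/subspace_continuousP => p0 Sp0.
rewrite (_ : loss s h fI P = fun p => (2 * N%:R)^-1 * \sum_(j < N)
    `|superposition Ufin Lh0 hL (preactivation (fI j) p) - P j| ^+ 2); last first.
  by apply/funext => p; rewrite lossE.
apply: cvgM; first exact: cvg_cst.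
apply: cvg_ord_sum => j.
have h1 : `|superposition Ufin Lh0 hL (preactivation (fI j) p) - P j| @[p --> within S0 (nbhs p0)]
  --> (`|superposition Ufin Lh0 hL (preactivation (fI j) p0) - P j| : R).
  have FW : Filter (within S0 (nbhs p0)) by apply: within_filter; exact: nbhs_filter.
  apply: (@cvgrPdist_lt _ R _ _ FW _ _).2 => e e0.
  have L1 : 0 < Lh + 1 by rewrite ltr_wpDl.
  have eL : 0 < e / (Lh + 1) by rewrite divr_gt0.
  apply: (@filterS _ _ (nbhs_filter p0) _ _ _
    (near_preactivation (fI j) p0 eL)) => p hp Sp.
  have {}hp : `|preactivation (fI j) p0 - preactivation (fI j) p| < e / (Lh + 1).
    exact: hp.
  rewrite (le_lt_trans (ler_dist_dist _ _))// opprB addrA subrK.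
  rewrite (le_lt_trans (superposition_lipschitz _ _ _ _ _))//.
  rewrite (@le_lt_trans _ _ ((Lh + 1) * `|preactivation (fI j) p0 - preactivation (fI j) p|))//.
    by rewrite ler_wpM2r ?normr_ge0// lerDl.
  by rewrite mulrC -ltr_pdivlMr.
exact: (cvgM h1 h1).
Qed.

End loss.
End network.

Theorem theorem2 (R : realType) (d l : nat)
  (Y : set 'rV[R]_d) (U : set 'rV[R]_l)
  (oY : open Y) (oU : open U) (bY : bounded_set Y) (bU : bounded_set U)
  (T : R) (T0 : 0 < T) (N : nat) (N0 : (0 < N)%N)
  (sigma h : R -> R) (lip_sigma : lipschitz sigma) (lip_h : lipschitz h)
  (fI : 'I_N -> L2 (lebesgue_on oY)) (P : 'I_N -> L2 (lebesgue_on oU))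
  (fI_neq : forall i j, i != j -> ~ (fI i = fI j %[ae lebesgue_on oY]))
  (S0 : set (param_space oY oU T)) (S0_neq0 : S0 !=set0)
  (S0_compact : compact S0) :
  exists2 p0, S0 p0 &
    loss sigma h fI P p0 = inf (loss sigma h fI P @` S0).
Proof.
have [L L0 sL] := lipschitz_bound lip_sigma.
have [Lh Lh0 hL] := lipschitz_bound lip_h.
have Yfin := bounded_lebesgue_on_fin oY bY.
have Ufin := bounded_lebesgue_on_fin oU bU.
have cl : {within S0, continuous (loss sigma h fI P)}.
  exact: (loss_continuous T0 Yfin Ufin L0 Lh0 sL hL S0_compact).
have [p0 /set_mem Sp0 min_p0] := compact_EVT_min S0_neq0 S0_compact cl.
have lbp0 : lbound (loss sigma h fI P @` S0) (loss sigma h fI P p0).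
  by move=> _ [p Sp <-]; apply: min_p0; exact: mem_set.
exists p0 => //; apply/eqP; rewrite eq_le; apply/andP; split.
  by apply: lb_le_inf => //; exists (loss sigma h fI P p0), p0.
(* [inf] is meaningful only for a set bounded below; the minimal value itself is such a bound. *)
by apply: ge_inf; [exists (loss sigma h fI P p0)|exists p0].
Qed.
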